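(* Let $\mathcal C$ be a connected cogroupoid over a field $\Bbbk$ such that $S_{X',Y'}$ is bijective for all $X',Y'\in\mathrm{ob}(\mathcal C)$. Let $X,Y\in\mathrm{ob}(\mathcal C)$ be two objects such that $\mathcal C(X,X)$ and $\mathcal C(Y,Y)$ are both twisted Calabi-Yau algebras. Then $$(S_{Y,X}\circ S_{X,Y})^2=[\eta]^r_{X,Y}\circ([\xi]^l_{X,Y})^{-1}\circ\gamma,$$ where $\xi:\mathcal C(X,X)\to\Bbbk$ and $\eta:\mathcal C(Y,Y)\to\Bbbk$ are the algebra homomorphisms given by the left homological integrals $\int^l_{\mathcal C(X,X)}=\Bbbk_\xi$ and $\int^l_{\mathcal C(Y,Y)}=\Bbbk_\eta$ respectively, and $\gamma$ is an inner automorphism of $\mathcal C(X,Y)$.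
   Context: All algebras and tensor products are over a fixed field $\Bbbk$. Cogroupoids. A cocategory $\mathcal C$ consists of a set $\mathrm{ob}(\mathcal C)$; an algebra $\mathcal C(X,Y)$ for all $X,Y\in\mathrm{ob}(\mathcal C)$; and algebra homomorphisms $\Delta^Z_{X,Y}:\mathcal C(X,Y)\to\mathcal C(X,Z)\otimes\mathcal C(Z,Y)$ and $\varepsilon_X:\mathcal C(X,X)\to\Bbbk$ such that $(\Delta^T_{X,Z}\otimes 1)\Delta^Z_{X,Y}=(1\otimes\Delta^Z_{T,Y})\Delta^T_{X,Y}$ and $(1\otimes\varepsilon_Y)\Delta^Y_{X,Y}=\mathrm{id}=(\varepsilon_X\otimes 1)\Delta^X_{X,Y}$. It is connected if every $\mathcal C(X,Y)$ is nonzero. A cogroupoid is a cocategory with linear maps $S_{X,Y}:\mathcal C(X,Y)\to\mathcal C(Y,X)$ such that $m(1\otimes S_{Y,X})\Delta^Y_{X,X}=u\varepsilon_X:\mathcal C(X,X)\to\mathcal C(X,Y)$ and $m(S_{X,Y}\otimes1)\Delta^Y_{X,X}=u\varepsilon_X:\mathcal C(X,X)\to\mathcal C(Y,X)$, with $m$ multiplication and $u$ unit. Each $\mathcal C(X,X)$ is a Hopf algebra with antipode $S_{X,X}$. Sweedler notation: $\Delta^Z_{X,Y}(a^{X,Y})=a_1^{X,Z}\otimes a_2^{Z,Y}$. Twisted Calabi-Yau. For an algebra $A$, $A^e=A\otimes A^{op}$; $A$ is twisted Calabi-Yau of dimension $d$ if $A$ has a bounded resolution by finitely generated projective $A^e$-modules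 and there is an algebra automorphism $\mu$ of $A$ with $\mathrm{Ext}^i_{A^e}(A,A^e)=0$ for $i\ne d$ and $\mathrm{Ext}^d_{A^e}(A,A^e)\cong A^\mu$ as $A^e$-modules, where $A^\mu=A$ with $a\cdot m\cdot b=am\mu(b)$. Homological integral. If a Hopf algebra $H$ with bijective antipode is twisted Calabi-Yau of dimension $d$, then $\mathrm{Ext}^d_H({}_\varepsilon\Bbbk,H)$ is one dimensional (${}_\varepsilon\Bbbk$ is the left trivial module defined by the counit); it is a right $H$-module via right multiplication on $H$, denoted $\int^l_H$. Writing $\int^l_H=\Bbbk_\xi$ means that $h\in H$ acts on it from the right by the scalar $\xi(h)$, with $\xi:H\to\Bbbk$ an algebra homomorphism. Winding automorphisms of $\mathcal C(X,Y)$: for algebra homomorphisms $\xi:\mathcal C(X,X)\to\Bbbk$ and $\eta:\mathcal C(Y,Y)\to\Bbbk$, $[\xi]^l_{X,Y}(a^{X,Y})=\xi(a_1^{X,X})a_2^{X,Y}$ and $[\eta]^r_{X,Y}(a^{X,Y})=a_1^{X,Y}\eta(a_2^{Y,Y})$. *)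

(* Defs.v *)
From HB Require Import structures.
From mathcomp Require Import all_boot all_order all_algebra.
From mathcomp Require Import boolp classical_sets functions.

Set Implicit Arguments.
Unset Strict Implicit.
Unset Printing Implicit Defensive.

Import GRing.Theory.
Local Open Scope ring_scope.
Local Open Scope quotient_scope.

Section FreeModule.
Variables (R : pzRingType) (X : choiceType).

Definition finsupp : {pred X -> R^o} :=
  fun f => `[< exists s : seq X, forall x, x \notin s -> f x = 0 >].

Fact finsupp_submod : submod_closed finsupp.
Proof.
split=> [|c f g /asboolP[s sP] /asboolP[t tP]]; apply/asboolP.
  by exists [::].
exists (s ++ t) => x; rewrite mem_cat negb_or => /andP[/sP f0 /tP g0].
by rewrite [LHS](_ : _ = c *: f x + g x)// f0 g0 scaler0 addr0.
Qed.
HB.instance Definition _ :=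
  GRing.isSubmodClosed.Build R (X -> R^o) finsupp finsupp_submod.

(* The free left module on the set X, as finitely supported functions. *)
Record freemod := Freemod { freemod_val :> X -> R^o; _ : freemod_val \in finsupp }.
HB.instance Definition _ := [isSub for freemod_val].
HB.instance Definition _ := [Choice of freemod by <:].
HB.instance Definition _ := [SubChoice_isSubLmodule of freemod by <:].

Fact basis_subproof (x : X) : (fun y => (x == y)%:R) \in finsupp.
Proof.
by apply/asboolP; exists [:: x] => y; rewrite inE eq_sym => /negPf ->.
Qed.
Definition basis x := Freemod (basis_subproof x).

Implicit Types a b : freemod.

Definition supp (a : freemod) : seq X :=
  undup (projT1 (cid (asboolW (valP a)))).

Lemma supp_uniq a : uniq (supp a). Proof. exact: undup_uniq. Qed.

Lemma suppP a x : x \notin supp a -> a x = 0.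
Proof. by rewrite mem_undup; case: cid => s /= sP; exact: sP. Qed.

Variables (M : lmodType R) (f : X -> M).

Definition freelift (a : freemod) : M := \sum_(x <- supp a) (a x : R) *: f x.

Lemma freeliftE a (s : seq X) : uniq s -> {subset supp a <= s} ->
  freelift a = \sum_(x <- s) (a x : R) *: f x.
Proof.
move=> us sub; rewrite (bigID (mem (supp a))) /= addrC big1 ?add0r => [|x].
  rewrite -big_filter; apply: perm_big; apply: uniq_perm.
  - exact: supp_uniq.
  - exact: filter_uniq.
  by move=> x; rewrite mem_filter /=; case: (boolP (x \in _)) => // /sub.
by move=> /suppP ->; rewrite scale0r.
Qed.

Fact freelift_is_linear : linear freelift.
Proof.
move=> c a b; pose s := undup (supp (c *: a + b) ++ supp a ++ supp b).
have us : uniq s by exact: undup_uniq.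
rewrite !(@freeliftE _ s) //; try by move=> x xs; rewrite mem_undup !mem_cat xs ?orbT.
rewrite scaler_sumr -big_split; apply: eq_bigr => x _ /=.
by rewrite scalerA -scalerDl.
Qed.
HB.instance Definition _ :=
  GRing.isLinear.Build R freemod M _ freelift freelift_is_linear.

Lemma freelift_basis x : freelift (basis x) = f x.
Proof.
rewrite (@freeliftE _ (undup (x :: supp (basis x)))) ?undup_uniq //.
  rewrite (bigD1_seq x) ?undup_uniq ?mem_undup ?mem_head //= eqxx scale1r.
  by rewrite big1 ?addr0 // => y /negPf; rewrite eq_sym => ->; rewrite scale0r.
by move=> y ys; rewrite mem_undup inE ys orbT.
Qed.

End FreeModule.
Arguments freelift {R X M} f a.
Arguments basis {R X} x.

Lemma freemod_basisE (R : pzRingType) (X : choiceType) (a : freemod R X) :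
  a = freelift basis a.
Proof.
apply/val_inj/funext => x /=.
have -> : val (freelift basis a) x = \sum_(y <- supp a) (a y : R) * (y == x)%:R.
  rewrite /freelift; elim/big_rec2: _ => //= y u v _ <-; by [].
have [xa|xa] := boolP (x \in supp a); last first.
  rewrite big_seq big1 ?(suppP xa) // => y ya.
  by case: eqP xa ya => [->/negPf->|] //; rewrite mulr0.
rewrite (bigD1_seq x) ?supp_uniq //= eqxx mulr1 big1 ?addr0 // => y /negPf ->.
by rewrite mulr0.
Qed.

Section FreeModuleTheory.
Variables (R : pzRingType) (X : choiceType) (M : lmodType R).

Lemma freemod_ext (g h : {linear freemod R X -> M}) :
  (forall x, g (basis x) = h (basis x)) -> g =1 h.
Proof.
move=> gh a; rewrite (freemod_basisE a) /freelift !linear_sum.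
by apply: eq_bigr => x _; rewrite !linearZ gh.
Qed.
End FreeModuleTheory.

Section Tensor.
Variables (k : fieldType) (V W : lmodType k).

Definition fp (v : V) (w : W) : freemod k (V * W)%type := basis (v, w).

(* The subspace of bilinearity relations. *)
Inductive tens_rel : freemod k (V * W)%type -> Prop :=
| TensRel0 : tens_rel 0
| TensRelD a b : tens_rel a -> tens_rel b -> tens_rel (a + b)
| TensRelZ c a : tens_rel a -> tens_rel (c *: a)
| TensRelDl v v' w : tens_rel (fp (v + v') w - fp v w - fp v' w)
| TensRelDr v w w' : tens_rel (fp v (w + w') - fp v w - fp v w')
| TensRelZl c v w : tens_rel (fp (c *: v) w - c *: fp v w)
| TensRelZr c v w : tens_rel (fp v (c *: w) - c *: fp v w).

Definition tens_relb : {pred freemod k (V * W)%type} := fun a => `[< tens_rel a >].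

Fact tens_rel_submod : submod_closed tens_relb.
Proof.
split=> [|c a b /asboolP ra /asboolP rb]; apply/asboolP; first exact: TensRel0.
by apply: TensRelD => //; exact: TensRelZ.
Qed.
HB.instance Definition _ :=
  GRing.isSubmodClosed.Build k (freemod k (V * W)%type) tens_relb tens_rel_submod.

Definition tens : Type := Quotient.quot tens_relb.
HB.instance Definition _ := GRing.Zmodule.copy tens (Quotient.quot tens_relb).
HB.instance Definition _ := EqQuotient.on tens.

Definition tens_proj (a : freemod k (V * W)%type) : tens := \pi_(Quotient.quot tens_relb) a.

Lemma tens_projP a b : tens_proj a = tens_proj b <-> tens_rel (a - b).
Proof.
split=> [/eqP|r]; last apply/eqP; rewrite -Quotient.idealrBE; last exact/asboolP.
by move/asboolP.
Qed.

Lemma tens_projK t : tens_proj (repr (t : Quotient.quot tens_relb)) = t.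
Proof. exact: reprK. Qed.

Fact tens_proj_additive : zmod_morphism tens_proj.
Proof. by move=> a b; rewrite /tens_proj !piE. Qed.
HB.instance Definition _ :=
  GRing.isZmodMorphism.Build _ tens tens_proj tens_proj_additive.

Lemma tens_projD a b : tens_proj (a + b) = tens_proj a + tens_proj b.
Proof. exact: raddfD. Qed.

Definition tens_scale (c : k) (t : tens) : tens :=
  tens_proj (c *: repr (t : Quotient.quot tens_relb)).

Lemma tens_projZ c a : tens_proj (c *: a) = tens_scale c (tens_proj a).
Proof.
apply/tens_projP; rewrite -scalerBr; apply: TensRelZ.
by apply/tens_projP; rewrite tens_projK.
Qed.

Fact tens_scaleA a b t : tens_scale a (tens_scale b t) = tens_scale (a * b) t.
Proof. by rewrite -[t]tens_projK -!tens_projZ scalerA. Qed.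
Fact tens_scale1 : left_id 1 tens_scale.
Proof. by move=> t; rewrite -[t]tens_projK -!tens_projZ scale1r. Qed.
Fact tens_scaleDr : right_distributive tens_scale +%R.
Proof.
move=> c t u; rewrite -[t]tens_projK -[u]tens_projK -tens_projD -!tens_projZ.
by rewrite -tens_projD scalerDr.
Qed.
Fact tens_scaleDl t : {morph tens_scale^~ t : a b / a + b}.
Proof.
move=> a b /=; rewrite -[t]tens_projK -!tens_projZ -tens_projD.
by rewrite scalerDl.
Qed.
HB.instance Definition _ := GRing.Zmodule_isLmodule.Build k tens
  tens_scaleA tens_scale1 tens_scaleDr tens_scaleDl.

Fact tens_proj_scalable : scalable tens_proj.
Proof. exact: tens_projZ. Qed.
HB.instance Definition _ :=
  GRing.isScalable.Build k _ tens _ tens_proj tens_proj_scalable.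

Definition tmul (v : V) (w : W) : tens := tens_proj (fp v w).

Lemma tmulDl v v' w : tmul (v + v') w = tmul v w + tmul v' w.
Proof.
by rewrite /tmul -tens_projD; apply/tens_projP; rewrite opprD addrA; exact: TensRelDl.
Qed.
Lemma tmulDr v w w' : tmul v (w + w') = tmul v w + tmul v w'.
Proof.
by rewrite /tmul -tens_projD; apply/tens_projP; rewrite opprD addrA; exact: TensRelDr.
Qed.
Lemma tmulZl c v w : tmul (c *: v) w = c *: tmul v w.
Proof. by rewrite /tmul -linearZ; apply/tens_projP; exact: TensRelZl. Qed.
Lemma tmulZr c v w : tmul v (c *: w) = c *: tmul v w.
Proof. by rewrite /tmul -linearZ; apply/tens_projP; exact: TensRelZr. Qed.

Definition bilinear_fun (U : lmodType k) (B : V -> W -> U) :=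
  (forall v, linear (B v)) /\ (forall w, linear (B^~ w)).

Section Lift.
Variables (U : lmodType k) (B : V -> W -> U).

(* Meaningful for bilinear B only, see tens_liftE. *)
Definition tens_lift (t : tens) : U :=
  freelift (fun vw => B vw.1 vw.2) (repr (t : Quotient.quot tens_relb)).

Hypothesis B_bil : bilinear_fun B.

Lemma tens_lift_proj a :
  tens_lift (tens_proj a) = freelift (fun vw => B vw.1 vw.2) a.
Proof.
have [Br Bl] := B_bil; apply/eqP; rewrite /tens_lift -subr_eq0 -linearB; apply/eqP.
set b := (X in freelift _ X = _); have : tens_rel b by apply/tens_projP/tens_projK.
elim=> {b} [|a0 b _ + _|c b _|v v' w|v w w'|c v w|c v w].
- exact: linear0.
- by rewrite linearD /= => -> ->; rewrite addr0.
- by rewrite linearZ /= => ->; rewrite scaler0.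
- rewrite !linearB /= !freelift_basis /= -addrA -opprD.
  by have := Bl w 1 v v'; rewrite /= !scale1r => ->; rewrite subrr.
- rewrite !linearB /= !freelift_basis /= -addrA -opprD.
  by have := Br v 1 w w'; rewrite /= !scale1r => ->; rewrite subrr.
- rewrite linearB linearZ /= !freelift_basis /=.
  by rewrite (scalable_linear (Bl w)) subrr.
- rewrite linearB linearZ /= !freelift_basis /=.
  by rewrite (scalable_linear (Br v)) subrr.
Qed.

Lemma tens_liftE v w : tens_lift (tmul v w) = B v w.
Proof. by rewrite tens_lift_proj freelift_basis. Qed.

Lemma tens_lift_is_linear : linear tens_lift.
Proof.
move=> c t u; rewrite -[t]tens_projK -[u]tens_projK -linearZ -linearD.
by rewrite !tens_lift_proj linearP.
Qed.
End Lift.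

Lemma linearD_fun (U U' : lmodType k) (f : U -> U') :
  linear f -> {morph f : x y / x + y}.
Proof. by move=> fL x y; have := fL 1 x y; rewrite !scale1r. Qed.

Lemma tens_ind (P : tens -> Prop) :
  (forall v w, P (tmul v w)) -> (forall t u, P t -> P u -> P (t + u)) ->
  forall t, P t.
Proof.
move=> Pm PD t; rewrite -[t]tens_projK.
have P0 : P 0.
  have -> : 0 = tmul 0 0 by rewrite -(scale0r (0 : V)) tmulZl scale0r.
  exact: Pm.
rewrite (freemod_basisE (repr _)) /freelift linear_sum.
elim/big_rec: _ => // -[v w] u _ Pu; apply: (PD _ _ _ Pu).
by rewrite linearZ /= -[X in P (_ *: X)]/(tmul v w) -tmulZl; exact: Pm.
Qed.

End Tensor.
Arguments tmul {k V W} v w.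
Arguments linearD_fun {k U U' f}.
Notation "V '⊗' W" := (tens V W) (at level 40, left associativity) : type_scope.

Section TensorMaps.
Variables (k : fieldType).
Implicit Types V W U : lmodType k.

Definition tens_map V V' W W' (f : V -> V') (g : W -> W') : V ⊗ W -> V' ⊗ W' :=
  tens_lift (fun v w => tmul (f v) (g w)).

(* (u ⊗ v) ⊗ w |-> u ⊗ (v ⊗ w) *)
Definition tens_assoc U V W : (U ⊗ V) ⊗ W -> U ⊗ (V ⊗ W) :=
  tens_lift (fun t w => tens_lift (fun u v => tmul u (tmul v w)) t).

(* k ⊗ V -> V, V ⊗ k -> V *)
Definition tens_lunit V : k^o ⊗ V -> V := tens_lift (fun (c : k^o) (v : V) => (c : k) *: v).
Definition tens_runit V : V ⊗ k^o -> V := tens_lift (fun (v : V) (c : k^o) => (c : k) *: v).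

Lemma tens_map_bil V V' W W' (f : {linear V -> V'}) (g : {linear W -> W'}) :
  bilinear_fun (fun v w => tmul (f v) (g w)).
Proof.
by split=> [v|w] c x y; rewrite linearP ?tmulDr ?tmulZr ?tmulDl ?tmulZl.
Qed.

Lemma tens_mapE V V' W W' (f : {linear V -> V'}) (g : {linear W -> W'}) v w :
  tens_map f g (tmul v w) = tmul (f v) (g w).
Proof. by rewrite /tens_map tens_liftE //; exact: tens_map_bil. Qed.

Lemma tens_assoc_bil U V W (w : W) :
  bilinear_fun (fun (u : U) (v : V) => tmul u (tmul v w)).
Proof.
split=> [u|v] c x y; last by rewrite tmulDl tmulZl.
by rewrite tmulDl tmulDr tmulZl tmulZr.
Qed.

Lemma tens_assocE U V W (u : U) (v : V) (w : W) :
  tens_assoc (tmul (tmul u v) w) = tmul u (tmul v w).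
Proof.
rewrite /tens_assoc !tens_liftE //; first exact: tens_assoc_bil.
split=> [t|w'] c x y; last exact: (tens_lift_is_linear (tens_assoc_bil U V w')).
elim/tens_ind: t => [u' v'|s t IHs IHt].
  rewrite !tens_liftE; try exact: tens_assoc_bil.
  by rewrite !tmulDr !tmulZr.
have L w' := linearD_fun (tens_lift_is_linear (tens_assoc_bil U V w')).
by rewrite !L IHs IHt scalerDr addrACA.
Qed.

Lemma tens_lunitE V c (v : V) : tens_lunit (tmul (c : k^o) v) = c *: v.
Proof.
rewrite /tens_lunit tens_liftE //; split=> [a|w] d x y /=.
  by rewrite scalerDr !scalerA mulrC.
by rewrite scalerDl -scalerA.
Qed.

Lemma tens_runitE V c (v : V) : tens_runit (tmul v (c : k^o)) = c *: v.
Proof.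
rewrite /tens_runit tens_liftE //; split=> [w|a] d x y /=.
  by rewrite scalerDl -scalerA.
by rewrite scalerDr !scalerA mulrC.
Qed.

End TensorMaps.

Section Functional.
Variables (k : fieldType) (V : lmodType k) (v : V).
Hypothesis v_neq0 : v != 0.

Lemma exists_functional : exists f : V -> k^o, linear f /\ f v = 1.
Proof.
pose P (S : set V) :=
  (forall c x y, S x -> S y -> S (c *: x + y)) /\ ~ S v.
have [F FP totF|S [[SP Sv] Smax]] := @Zorn_bigcup V P.
  split=> [c x y [A FA Ax] [B FB By]|[A FA Av]]; last by case: (FP _ FA).
  case: (totF _ _ FA FB) => [/(_ x Ax)|/(_ y By)] h.
    by exists B => //; apply: (proj1 (FP _ FB)).
  by exists A => //; apply: (proj1 (FP _ FA)).
pose S0 x := S x \/ x = 0.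
have S0P c x y : S0 x -> S0 y -> S0 (c *: x + y).
  case=> [Sx|->] [Sy|->]; last by right; rewrite scaler0 addr0.
  - by left; exact: SP.
  - case: (eqVneq x 0) => [->|x0]; first by right; rewrite scaler0 addr0.
    have S0' : S 0 by rewrite -(addNr x) -scaleN1r; exact: SP.
    by left; exact: SP.
  - by rewrite scaler0 add0r; left.
have S00 : S0 0 by right.
have S0Z c x : S0 x -> S0 (c *: x).
  by move=> Sx; rewrite -[_ *: _]addr0; exact: S0P.
have S0v : ~ S0 v by case=> [//|v0]; move: v_neq0; rewrite v0 eqxx.
have span x : exists c : k, S0 (x - c *: v).
  case: (pselect (S0 x)) => [Sx|nSx]; first by exists 0; rewrite scale0r subr0.
  pose B := (fun y => exists c : k, S0 (y - c *: x)) : set V.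
  have BP c y z : B y -> B z -> B (c *: y + z).
    move=> [a Ha] [b Hb]; exists (c * a + b).
    have -> : c *: y + z - (c * a + b) *: x = c *: (y - a *: x) + (z - b *: x).
      by rewrite scalerBr scalerDl opprD addrACA scalerA.
    exact: S0P.
  have [[c Hc]|nBv] := pselect (B v).
    have c0 : c != 0.
      by apply/eqP => c0; move: Hc; rewrite c0 scale0r subr0.
    exists c^-1; have := S0Z (- c^-1) _ Hc.
    rewrite scalerBr scaleNr scaleNr opprK scalerA mulVf // scale1r.
    by rewrite addrC.
  case: (Smax B) => //; split=> [y Sy|].
    by exists 0; rewrite scale0r subr0; left.
  move/(_ x) => h; apply: nSx; left; apply: h.
  by exists 1; rewrite scale1r subrr.
have uniq_c x c c' : S0 (x - c *: v) -> S0 (x - c' *: v) -> c = c'.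
  move=> h h'; apply/eqP; rewrite -subr_eq0; apply/negPn/negP => cc.
  apply: S0v; have := S0Z (c - c')^-1 _ (S0P (-1) _ _ h h').
  rewrite scaleN1r opprB addrA subrK -scalerBl scalerA mulVf //.
  by rewrite scale1r.
pose f x : k^o := projT1 (cid (span x)).
have fP x : S0 (x - (f x : k) *: v) by rewrite /f; case: cid.
exists f; split=> [c x y|]; last first.
  by apply: (uniq_c v) => //; rewrite scale1r subrr.
apply: (uniq_c (c *: x + y)) => //.
have -> : c *: x + y - (c *: f x + f y : k) *: v =
          c *: (x - (f x : k) *: v) + (y - (f y : k) *: v).
  by rewrite scalerBr scalerDl opprD addrACA scalerA.
exact: S0P.
Qed.

End Functional.

HB.instance Definition _ (k : pzRingType) (V : lmodType k) :=
  GRing.Lmodule.copy V^c V.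
HB.instance Definition _ (k : pzRingType) (A : algType k) :=
  GRing.LSemiModule_isLSemiAlgebra.Build k A^c
    (fun c x y => @scalerAr k A c y x).
HB.instance Definition _ (k : pzRingType) (A : algType k) :=
  GRing.LSemiAlgebra_isSemiAlgebra.Build k A^c
    (fun c x y => @scalerAl k A c y x).

Section TensorAlgebra.
Variables (k : fieldType) (A B : algType k).
Implicit Types t u v : A ⊗ B.

Lemma tmul_mul_bil (a : A) (b : B) :
  bilinear_fun (fun a' b' => tmul (a * a') (b * b') : A ⊗ B).
Proof.
split=> [a'|b'] c x y; rewrite mulrDr.
  by rewrite -scalerAr tmulDr tmulZr.
by rewrite -scalerAr tmulDl tmulZl.
Qed.

Definition tens_mul t u : A ⊗ B :=
  tens_lift (fun a b => tens_lift (fun a' b' => tmul (a * a') (b * b')) u) t.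

Lemma tens_mul_bil u : bilinear_fun
  (fun (a : A) (b : B) => tens_lift (fun a' b' => tmul (a * a') (b * b') : A ⊗ B) u).
Proof.
split=> [a|b] c x y; elim/tens_ind: u => [a' b'|u v IHu IHv].
- rewrite !tens_liftE; try exact: tmul_mul_bil.
  by rewrite mulrDl tmulDr -scalerAl tmulZr.
- have L b := linearD_fun (tens_lift_is_linear (tmul_mul_bil a b)).
  by rewrite !L IHu IHv scalerDr addrACA.
- rewrite !tens_liftE; try exact: tmul_mul_bil.
  by rewrite mulrDl tmulDl -scalerAl tmulZl.
- have L a := linearD_fun (tens_lift_is_linear (tmul_mul_bil a b)).
  by rewrite !L IHu IHv scalerDr addrACA.
Qed.

Lemma tens_mulE a b a' b' :
  tens_mul (tmul a b) (tmul a' b') = tmul (a * a') (b * b').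
Proof.
by rewrite /tens_mul tens_liftE ?tens_liftE //; [exact: tmul_mul_bil|exact: tens_mul_bil].
Qed.

Lemma tens_mulP c t u v : tens_mul (c *: t + u) v = c *: tens_mul t v + tens_mul u v.
Proof. exact: tens_lift_is_linear (tens_mul_bil v) c t u. Qed.

Lemma tens_mulDl : left_distributive tens_mul +%R.
Proof. by move=> t u v; have := tens_mulP 1 t u v; rewrite !scale1r. Qed.

Lemma tens_mulDr : right_distributive tens_mul +%R.
Proof.
move=> t u v; elim/tens_ind: t => [a b|t t' IH IH'].
  rewrite /tens_mul !tens_liftE; try exact: tens_mul_bil.
  exact: (linearD_fun (tens_lift_is_linear (tmul_mul_bil a b))).
by rewrite !tens_mulDl IH IH' addrACA.
Qed.

Lemma tens_mulA : associative tens_mul.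
Proof.
move=> t u v; elim/tens_ind: t => [a b|t t' IH IH']; last by rewrite !tens_mulDl IH IH'.
elim/tens_ind: u => [a' b'|u u' IH IH']; last first.
  by rewrite tens_mulDl !tens_mulDr tens_mulDl IH IH'.
elim/tens_ind: v => [a'' b''|v v' IH IH']; last by rewrite !tens_mulDr IH IH'.
by rewrite !tens_mulE !mulrA.
Qed.

Lemma tens_mul1l : left_id (tmul 1 1) tens_mul.
Proof.
elim/tens_ind=> [a b|t u IH IH']; first by rewrite tens_mulE !mul1r.
by rewrite tens_mulDr IH IH'.
Qed.

Lemma tens_mul1r : right_id (tmul 1 1) tens_mul.
Proof.
elim/tens_ind=> [a b|t u IH IH']; first by rewrite tens_mulE !mulr1.
by rewrite tens_mulDl IH IH'.
Qed.

Lemma tens1_neq0 : tmul 1 1 != 0 :> A ⊗ B.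
Proof.
have [f [fL f1]] := exists_functional (oner_neq0 A).
have [g [gL g1]] := exists_functional (oner_neq0 B).
have fg : bilinear_fun (fun a b => (f a : k) *: g b).
  split=> [a|b] c x y; first by rewrite gL scalerDr !scalerA mulrC.
  by rewrite fL scalerDl -scalerA.
apply/eqP => h; have := tens_liftE fg 1 1; rewrite h f1 g1 scale1r.
have := tens_lift_is_linear fg (-1) 0 0; rewrite scaler0 addr0 scaleN1r addNr => ->.
by move/eqP; rewrite eq_sym (negPf (oner_neq0 k)).
Qed.

HB.instance Definition _ := GRing.Zmodule_isNzRing.Build (A ⊗ B)
  tens_mulA tens_mul1l tens_mul1r tens_mulDl tens_mulDr tens1_neq0.

Lemma tmulM (a a' : A) (b b' : B) :
  (tmul a b : A ⊗ B) * tmul a' b' = tmul (a * a') (b * b').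
Proof. exact: tens_mulE. Qed.

Fact tens_scalerAl c t u : c *: (t * u) = (c *: t) * u.
Proof.
have E : (c *: t + 0) * u = c *: (t * u) + 0 * u := tens_mulP c t 0 u.
by rewrite addr0 mul0r addr0 in E.
Qed.

Fact tens_scalerAr c t u : c *: (t * u) = t * (c *: u).
Proof.
elim/tens_ind: t => [a b|t t' IH IH']; last by rewrite !mulrDl scalerDr IH IH'.
elim/tens_ind: u => [a' b'|u u' IH IH']; last by rewrite scalerDr !mulrDr scalerDr IH IH'.
by rewrite -tmulZl !tmulM -tmulZl scalerAr.
Qed.

HB.instance Definition _ :=
  GRing.LSemiModule_isLSemiAlgebra.Build k (A ⊗ B) tens_scalerAl.
HB.instance Definition _ :=
  GRing.LSemiAlgebra_isSemiAlgebra.Build k (A ⊗ B) tens_scalerAr.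
End TensorAlgebra.

(* The enveloping algebra A^e = A ⊗ A^op. *)
Notation envel A := (A ⊗ A^c).

Section RegularBimodule.
Variables (k : fieldType) (A : algType k).

(* A as a left A^e-module: (a ⊗ b) m = a m b. *)
Definition bimod : Type := A.
HB.instance Definition _ := GRing.Zmodule.copy bimod A.

Definition bimod_act (t : envel A) (m : bimod) : bimod :=
  tens_lift (fun (a : A) (b : A^c) => a * (m : A) * (b : A)) t.

Lemma bimod_act_bil (m : A) :
  bilinear_fun (fun (a : A) (b : A^c) => a * m * (b : A)).
Proof.
split=> [a|b] c x y.
  by rewrite mulrDr -scalerAr.
by rewrite !mulrDl -!scalerAl.
Qed.

Lemma bimod_actE (a : A) (b : A^c) (m : A) : bimod_act (tmul a b) m = a * m * (b : A).
Proof. by rewrite /bimod_act tens_liftE //; exact: bimod_act_bil. Qed.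

Lemma bimod_actDl (m : bimod) : {morph bimod_act^~ m : t u / t + u}.
Proof. exact: linearD_fun (tens_lift_is_linear (bimod_act_bil m)). Qed.

Fact bimod_actDr : right_distributive bimod_act +%R.
Proof.
move=> t m n; elim/tens_ind: t => [a b|t u IH IH'].
  by rewrite !bimod_actE mulrDr mulrDl.
by rewrite !bimod_actDl IH IH' addrACA.
Qed.

Fact bimod_actA (t u : envel A) m :
  bimod_act t (bimod_act u m) = bimod_act (t * u) m.
Proof.
elim/tens_ind: t => [a b|t t' IH IH']; last by rewrite mulrDl !bimod_actDl IH IH'.
elim/tens_ind: u => [a' b'|u u' IH IH'].
  by rewrite tmulM !bimod_actE !mulrA.
by rewrite mulrDr !bimod_actDl bimod_actDr IH IH'.
Qed.

Fact bimod_act1 : left_id 1 bimod_act.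
Proof. by move=> m; rewrite bimod_actE mulr1 mul1r. Qed.

HB.instance Definition _ := GRing.Zmodule_isLmodule.Build (envel A) bimod
  bimod_actA bimod_act1 bimod_actDr bimod_actDl.
End RegularBimodule.

(* The left H-module {}_eps k: h c = eps(h) c. *)
Definition trivmod (k : fieldType) (H : algType k)
  (eps : {lrmorphism H -> k^o}) : Type := k.

Section TrivialModule.
Variables (k : fieldType) (H : algType k) (eps : {lrmorphism H -> k^o}).
HB.instance Definition _ := GRing.Zmodule.copy (trivmod eps) k.

Definition triv_act (h : H) (c : trivmod eps) : trivmod eps := (eps h : k) * (c : k).
Fact triv_actA g h c : triv_act g (triv_act h c) = triv_act (g * h) c.
Proof. by rewrite /triv_act rmorphM mulrA. Qed.
Fact triv_act1 : left_id 1 triv_act.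
Proof. by move=> c; rewrite /triv_act rmorph1 mul1r. Qed.
Fact triv_actDr : right_distributive triv_act +%R.
Proof. by move=> h c d; rewrite /triv_act mulrDr. Qed.
Fact triv_actDl c : {morph triv_act^~ c : g h / g + h}.
Proof. by move=> g h; rewrite /triv_act rmorphD mulrDl. Qed.
HB.instance Definition _ := GRing.Zmodule_isLmodule.Build H (trivmod eps)
  triv_actA triv_act1 triv_actDr triv_actDl.
End TrivialModule.

Section HomGroup.
Variables (R : pzRingType) (M N : lmodType R).
Implicit Types f g h : {linear M -> N}.

Lemma linear_ext f g : f =1 g -> f = g.
Proof.
case: f g => [f [[fa] [fs]]] [g [[ga] [gs]]] /= /funext fg.
by case: g / fg ga gs => ga gs; congr GRing.Linear.Pack; congr GRing.Linear.Class;
   congr (_ _); exact: Prop_irrelevance.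
Qed.

HB.instance Definition _ := gen_eqMixin {linear M -> N}.
HB.instance Definition _ := gen_choiceMixin {linear M -> N}.

Definition hom_zero : {linear M -> N} := \0.
Definition hom_opp f : {linear M -> N} := \- f.
Definition hom_add f g : {linear M -> N} := f \+ g.

Fact hom_addA : associative hom_add.
Proof. by move=> f g h; apply: linear_ext => x /=; rewrite addrA. Qed.
Fact hom_addC : commutative hom_add.
Proof. by move=> f g; apply: linear_ext => x /=; rewrite addrC. Qed.
Fact hom_add0 : left_id hom_zero hom_add.
Proof. by move=> f; apply: linear_ext => x /=; rewrite add0r. Qed.
Fact hom_addN : left_inverse hom_zero hom_opp hom_add.
Proof. by move=> f; apply: linear_ext => x /=; rewrite addNr. Qed.
HB.instance Definition _ := GRing.isZmodule.Build {linear M -> N}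
  hom_addA hom_addC hom_add0 hom_addN.
End HomGroup.

Section Kernel.
Variables (R : pzRingType) (M N : lmodType R) (f : {linear M -> N}).
Definition kerp : {pred M} := fun x => f x == 0.
Fact kerp_submod : submod_closed kerp.
Proof.
split=> [|c x y /eqP fx /eqP fy]; apply/eqP; first exact: linear0.
by rewrite linearP fx fy scaler0 addr0.
Qed.
HB.instance Definition _ := GRing.isSubmodClosed.Build R M kerp kerp_submod.
Record ker := Ker { ker_val : M; _ : ker_val \in kerp }.
HB.instance Definition _ := [isSub for ker_val].
HB.instance Definition _ := [Choice of ker by <:].
HB.instance Definition _ := [SubChoice_isSubLmodule of ker by <:].
End Kernel.

Section FreeResolution.
Variables (R : pzRingType) (M : lmodType R).

Definition cover (N : lmodType R) : {linear freemod R N -> N} := freelift id.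

Fixpoint syz (n : nat) : lmodType R :=
  if n is m.+1 then ker (cover (syz m)) else M.

(* The canonical free resolution of M: fres n is free on the elements of the
   n-th syzygy module, which is the kernel of fres n.-1 -> syz n.-1. *)
Definition fres (n : nat) : lmodType R := freemod R (syz n).

Definition fres_aug : {linear fres 0 -> M} := cover M.
Definition fres_d (n : nat) : {linear fres n.+1 -> fres n} :=
  (val : ker (cover (syz n)) -> fres n) \o cover (syz n.+1).
End FreeResolution.

Section Projective.
Variable R : pzRingType.
Implicit Types M P : lmodType R.

Definition projective P := forall (B C : lmodType R)
  (g : {linear B -> C}) (f : {linear P -> C}),
  (forall c, exists b, g b = c) -> exists h : {linear P -> B}, g \o h =1 f.

Definition fin_generated P := exists (n : nat) (e : 'I_n -> P),
  forall x, exists c : 'I_n -> R, x = \sum_i c i *: e i.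

Definition exact_resolution M (P : nat -> lmodType R)
    (d : forall n, {linear P n.+1 -> P n}) (e : {linear P 0%N -> M}) :=
  [/\ forall x, exists y, e y = x,
      forall x, e x = 0 <-> exists y, d 0%N y = x
    & forall n x, d n x = 0 <-> exists y, d n.+1 y = x].

Definition has_bounded_fgproj_resolution M :=
  exists (P : nat -> lmodType R) (d : forall n, {linear P n.+1 -> P n})
         (e : {linear P 0%N -> M}),
    [/\ exact_resolution d e,
        forall n, projective (P n) /\ fin_generated (P n)
      & exists N : nat, forall n, (N <= n)%N -> forall x : P n, x = 0].

End Projective.

Section FreeResolutionTheory.
Variables (R : pzRingType) (M : lmodType R).

Lemma cover_surj (N : lmodType R) x : cover N (basis x) = x.
Proof. exact: freelift_basis. Qed.

Lemma freemod_projective (X : choiceType) : projective (freemod R X).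
Proof.
move=> B C g f gsurj; pose s x := projT1 (cid (gsurj (f (basis x)))).
have sP x : g (s x) = f (basis x) by rewrite /s; case: cid.
exists (freelift s) => a.
apply: (@freemod_ext _ _ _ (g \o freelift s) f) => x /=.
by rewrite freelift_basis.
Qed.

Lemma fres_projective n : projective (fres M n).
Proof. exact: freemod_projective. Qed.

Lemma ker_cover (N : lmodType R) (x : freemod R N) :
  cover N x = 0 <-> exists y, val (cover (ker (cover N)) y) = x.
Proof.
split=> [x0|[y <-]]; last exact/eqP/(valP (cover _ y)).
have xk : x \in kerp (cover N) by apply/eqP.
by exists (basis (Ker xk)); rewrite cover_surj.
Qed.

Lemma fres_exact : exact_resolution (@fres_d R M) (fres_aug M).
Proof.
split=> [x|x|n x]; first by exists (basis x); exact: cover_surj.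
  exact: ker_cover.
rewrite -(@ker_cover (syz M n.+1)); split=> [h|h]; last by rewrite /= h.
exact: val_inj.
Qed.
End FreeResolutionTheory.

Section Ext.
Variables (R : pzRingType) (n : nat) (M N : lmodType R).

Definition cocyclep : {pred {linear fres M n -> N}} :=
  fun f => `[< forall x, f (fres_d M n x) = 0 >].

Fact cocyclep_zmod : zmod_closed cocyclep.
Proof.
split=> [|f g /asboolP fc /asboolP gc]; apply/asboolP => // x.
by rewrite [LHS](_ : _ = f (fres_d M n x) - g (fres_d M n x)) // fc gc subr0.
Qed.
HB.instance Definition _ := GRing.isZmodClosed.Build _ cocyclep cocyclep_zmod.

Record cocycle := Cocycle {
  cocycle_val : {linear fres M n -> N}; _ : cocycle_val \in cocyclep }.
HB.instance Definition _ := [isSub for cocycle_val].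
HB.instance Definition _ := [Choice of cocycle by <:].
HB.instance Definition _ := [SubChoice_isSubZmodule of cocycle by <:].

Definition is_coboundary (m : nat) : {linear fres M m -> N} -> Prop :=
  match m with
  | 0%N => fun f => f = 0
  | p.+1 => fun f => exists g : {linear fres M p -> N},
                       forall x, f x = g (fres_d M p x)
  end.

Definition coboundaryp : {pred cocycle} :=
  fun f => `[< is_coboundary (cocycle_val f) >].

Fact coboundaryp_zmod : zmod_closed coboundaryp.
Proof.
rewrite /coboundaryp; split=> [|f g /asboolP fb /asboolP gb]; apply/asboolP.
  rewrite -[cocycle_val 0]/(0 : {linear fres M n -> N}).
  by case: n => //= p; exists 0.
rewrite -[cocycle_val (f - g)]/(cocycle_val f - cocycle_val g).
move: (cocycle_val f) (cocycle_val g) fb gb; case: n => [|p] u v /=.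
  by move=> -> ->; rewrite subrr.
move=> [u' uE] [v' vE]; exists (u' - v') => x.
by rewrite -[LHS]/(u x - v x) uE vE.
Qed.
HB.instance Definition _ := GRing.isZmodClosed.Build _ coboundaryp coboundaryp_zmod.

(* The n-th right derived functor of Hom_R(-, N) at M. *)
Definition Ext : Type := Quotient.quot coboundaryp.
HB.instance Definition _ := GRing.Zmodule.copy Ext (Quotient.quot coboundaryp).

Definition ext_class (f : cocycle) : Ext := \pi_(Quotient.quot coboundaryp) f.
Definition ext_repr (x : Ext) : cocycle := repr (x : Quotient.quot coboundaryp).

Lemma ext_reprK x : ext_class (ext_repr x) = x.
Proof. exact: reprK. Qed.

Lemma ext_classP f g :
  ext_class f = ext_class g <-> is_coboundary (cocycle_val f - cocycle_val g).
Proof.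
split=> [/eqP|r]; last apply/eqP; rewrite -Quotient.idealrBE; last exact/asboolP.
by move/asboolP.
Qed.
End Ext.

Section ExtMap.
Variables (R : pzRingType) (n : nat) (M N N' : lmodType R) (h : {linear N -> N'}).

Fact cocycle_map_subproof (f : cocycle n M N) :
  (h \o cocycle_val f : {linear fres M n -> N'}) \in @cocyclep R n M N'.
Proof.
by case: f => f /= /asboolP fc; apply/asboolP => x /=; rewrite fc linear0.
Qed.
Definition cocycle_map f := Cocycle (cocycle_map_subproof f).

(* Functoriality of Ext^n_R(M, -). *)
Definition ext_map (x : Ext n M N) : Ext n M N' :=
  ext_class (cocycle_map (ext_repr x)).

Lemma ext_mapE f : ext_map (ext_class f) = ext_class (cocycle_map f).
Proof.
apply/ext_classP; have /ext_classP := ext_reprK (ext_class f).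
move: (ext_repr _) => g /=; case: g f => [g gc] [f fc] /=; clear gc fc.
move: n g f => [|p] g f /=.
  by move/eqP; rewrite subr_eq0 => /eqP ->; rewrite subrr.
move=> [u uE]; exists (h \o u) => x /=; rewrite -uE.
by rewrite -[RHS]/(h (g x - f x)) linearB.
Qed.
End ExtMap.

Section ExtRightAction.
Variables (R : pzRingType) (n : nat) (M : lmodType R).

Definition rmul (r : R) (x : R^o) : R^o := (x : R) * r.
Fact rmul_is_linear r : linear (rmul r).
Proof. by move=> c x y; rewrite /rmul mulrDl -mulrA. Qed.
HB.instance Definition _ r :=
  GRing.isLinear.Build R R^o R^o _ (rmul r) (rmul_is_linear r).

(* The right R-module structure of Ext^n_R(M, R), induced by right
   multiplication on R. *)
Definition ext_ract (x : Ext n M R^o) (r : R) : Ext n M R^o := ext_map (rmul r) x.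
Lemma ext_ractD x y r : ext_ract (x + y) r = ext_ract x r + ext_ract y r.
Proof.
have classD : {morph @ext_class R n M R^o : f g / f + g}.
  by move=> f g; rewrite /ext_class; exact: raddfD.
rewrite -[x]ext_reprK -[y]ext_reprK -classD /ext_ract !ext_mapE -classD.
congr ext_class; apply/val_inj/linear_ext => z /=.
exact: mulrDl.
Qed.

Lemma ext_ractM x r s : ext_ract x (r * s) = ext_ract (ext_ract x r) s.
Proof.
rewrite -[x]ext_reprK; move: (ext_repr x) => f.
rewrite /ext_ract [ext_map (rmul r) _]ext_mapE !ext_mapE.
by congr ext_class; apply/val_inj/linear_ext => z /=; exact: mulrA.
Qed.
End ExtRightAction.

(* Convention: A^e has the commuting A-bimodule structures
   outer: a (x ⊗ y) b = ax ⊗ yb (the left regular A^e-module), used for Hom, and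
   inner: a (x ⊗ y) b = xb ⊗ ay, i.e. right multiplication by b ⊗ a in A^e,
   which makes Ext_{A^e}(A, A^e) a bimodule, i.e. an A^e-module.  The map phi
   below is an isomorphism of bimodules onto A^mu, where a.m.b = a m mu(b). *)
Definition twisted_calabi_yau (k : fieldType) (A : algType k) (d : nat) : Prop :=
  has_bounded_fgproj_resolution (bimod A : lmodType (envel A)) /\
  exists mu : {lrmorphism A -> A},
    [/\ bijective mu,
        forall i, i <> d -> forall x : Ext i (bimod A) (envel A)^o, x = 0
      & exists phi : {additive Ext d (bimod A) (envel A)^o -> A},
          bijective phi /\
          forall x (a b : A),
            phi (ext_ract x (tmul b (a : A^c))) = a * phi x * mu b].

(* The right H-module Ext^d_H({}_eps k, H) is isomorphic to k_xi, that is, it is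
   one-dimensional and h in H acts on it from the right by xi(h). *)
Definition left_homological_integral (k : fieldType) (H : algType k)
    (eps : {lrmorphism H -> k^o}) (d : nat) (xi : {lrmorphism H -> k^o}) : Prop :=
  exists phi : {additive Ext d (trivmod eps) H^o -> k},
    bijective phi /\ forall x h, phi (ext_ract x h) = phi x * xi h.

(* algType has 1 != 0, so the algebras of a cocategory are nonzero here and
   connected, below, holds automatically. *)
Record cocategory (k : fieldType) := Cocategory {
  ob : Type;
  coalg :> ob -> ob -> algType k;
  comul : forall X Y Z, {lrmorphism coalg X Y -> coalg X Z ⊗ coalg Z Y};
  counit : forall X, {lrmorphism coalg X X -> k^o};
  comulA : forall X Y Z T (a : coalg X Y),
    tens_assoc (tens_map (comul X Z T) idfun (comul X Y Z a))
    = tens_map idfun (comul T Y Z) (comul X Y T a);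
  counitr : forall X Y (a : coalg X Y),
    tens_runit (tens_map idfun (counit Y) (comul X Y Y a)) = a;
  counitl : forall X Y (a : coalg X Y),
    tens_lunit (tens_map (counit X) idfun (comul X Y X a)) = a
}.

Definition connected (k : fieldType) (C : cocategory k) : Prop :=
  forall X Y : ob C, exists a : C X Y, a <> 0.

Definition tens_mult (k : fieldType) (A : algType k) : A ⊗ A -> A :=
  tens_lift (fun a b => a * b).

Record cogroupoid (k : fieldType) := Cogroupoid {
  cogroupoid_cocategory :> cocategory k;
  antipode : forall X Y : ob cogroupoid_cocategory,
    {linear cogroupoid_cocategory X Y -> cogroupoid_cocategory Y X};
  antipoder : forall X Y (a : cogroupoid_cocategory X X),
    tens_mult (tens_map idfun (antipode Y X) (comul X X Y a))
    = (counit X a : k)%:A;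
  antipodel : forall X Y (a : cogroupoid_cocategory X X),
    tens_mult (tens_map (antipode X Y) idfun (comul X X Y a))
    = (counit X a : k)%:A
}.

Section Winding.
Variables (k : fieldType) (C : cocategory k) (X Y : ob C).

Definition winding_left (xi : {lrmorphism C X X -> k^o}) (a : C X Y) : C X Y :=
  tens_lunit (tens_map xi idfun (comul X Y X a)).

Definition winding_right (eta : {lrmorphism C Y Y -> k^o}) (a : C X Y) : C X Y :=
  tens_runit (tens_map idfun eta (comul X Y Y a)).
End Winding.

Definition inner_automorphism (A : pzRingType) (g : A -> A) : Prop :=
  exists u v : A, [/\ u * v = 1, v * u = 1 & forall a, g a = u * a * v].

(* Main.v *)
(* Write A = C(X, Y), H = C(X, X) and T = S_{Y,X} S_{X,Y}. Along the algebra map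
   D : H -> A^e, D(h) = h_1 ⊗ S(h_2), restriction has the exact left adjoint
   Q |-> Q ⊗ A, which sends k to A; hence Ext_{A^e}(A, M) = Ext_H(k, M). The case
   Y = X moves the finiteness of the H^e-resolution of H to k. Since A^e is
   H ⊗ A as a left H-module, Ext^n_{A^e}(A, A^e) = Ext^n_H(k, H) ⊗ A: it vanishes
   for n <> d, and for n = d it is a free left A-module on a class e such that
   e (b ⊗ 1) = e (1 ⊗ T [xi]^l(b)). The co-opposite cogroupoid exchanges H with
   C(Y, Y), and yields a second free generator of the same Ext group, with
   T^-1 [eta]^r in place of T [xi]^l. Two free generators differ by a unit of A,
   so T [xi]^l and T^-1 [eta]^r differ by an inner automorphism. *)
From HB Require Import structures.
Require Import Defs.
From mathcomp Require Import all_boot all_order all_algebra.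
From mathcomp Require Import boolp.

Set Implicit Arguments.
Unset Strict Implicit.
Unset Printing Implicit Defensive.

Import GRing.Theory.
Local Open Scope ring_scope.

(** * Comparison of resolutions *)

(** The twist comes from one identity in A^e: b ⊗ 1 = D(b_1) (1 ⊗ T(b_2)). A cocycle e with values
    in H that represents the integral satisfies e h ~ xi(h) e, so its image under D, multiplied by b
    ⊗ 1, becomes its multiple by 1 ⊗ xi(b_1) T(b_2). The co-opposite leaves each algebra C(X, Y)
    unchanged, hence also A^e and its Ext groups, so that the two generators can be compared. Its
    antipode is the inverse of S: this is where bijectivity is used, and why T^-1 appears. The
    obstacle is Ext_H(k, H ⊗ A) = Ext_H(k, H) ⊗ A when A has infinite dimension, since Hom out of
    the huge canonical resolution does not commute with direct sums. No finite resolution of k is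
    built: every cocycle is instead replaced by a cohomologous one whose values lie in a finitely
    generated submodule, and finite-rank projections do the work of a basis of A. All computations
    are made with cocycles up to coboundary. *)

Definition mklin (R : pzRingType) (M N : lmodType R) (f : M -> N)
    (fl : linear f) : {linear M -> N} :=
  HB.pack f (GRing.isLinear.Build R M N _ f fl).

Section Cochains.
Variables (R : pzRingType) (P : nat -> lmodType R).
Variable d : forall n, {linear P n.+1 -> P n}.

(** Taken on bare functions, so that cochains can be added and multiplied pointwise under a lambda
    without packing a linear structure each time. In degree 0 no differential comes in, and only
    zero is a coboundary. *)
Definition cobound (N : lmodType R) (n : nat) : (P n -> N) -> Prop :=
  match n with
  | 0%N => fun f => forall x, f x = 0
  | p.+1 => fun f => exists g : {linear P p -> N}, forall x, f x = g (d p x)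
  end.

Definition cohomologous (N : lmodType R) (n : nat) (f g : P n -> N) :=
  cobound (fun x => f x - g x).

Variable N : lmodType R.
Implicit Types n : nat.

Lemma eq_cobound n (f g : P n -> N) : f =1 g -> cobound f -> cobound g.
Proof. by move=> /funext ->. Qed.

Lemma cobound0 n : cobound (fun _ : P n => 0 : N).
Proof. by case: n => [|n] //=; exists 0. Qed.

Lemma coboundD n (f g : P n -> N) :
  cobound f -> cobound g -> cobound (fun x => f x + g x).
Proof.
case: n f g => [|n] f g /=; first by move=> f0 g0 x; rewrite f0 g0 addr0.
by move=> [u uE] [v vE]; exists (u + v) => x; rewrite uE vE.
Qed.

Lemma coboundN n (f : P n -> N) : cobound f -> cobound (fun x => - f x).
Proof.
case: n f => [|n] f /=; first by move=> f0 x; rewrite f0 oppr0.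
by move=> [u uE]; exists (- u) => x; rewrite uE.
Qed.

Lemma cohomologous_refl n (f : P n -> N) : cohomologous f f.
Proof. by apply: eq_cobound (cobound0 n) => x; rewrite subrr. Qed.

Lemma eq_cohomologous n (f g : P n -> N) : f =1 g -> cohomologous f g.
Proof. by move=> /funext ->; exact: cohomologous_refl. Qed.

Lemma cohomologous_sym n (f g : P n -> N) :
  cohomologous f g -> cohomologous g f.
Proof. by move=> /coboundN; apply: eq_cobound => x; rewrite opprB. Qed.

Lemma cohomologous_trans n (g f h : P n -> N) :
  cohomologous f g -> cohomologous g h -> cohomologous f h.
Proof.
by move=> fg gh; apply: eq_cobound (coboundD fg gh) => x; rewrite addrA subrK.
Qed.

Lemma cohomologousD n (f g f' g' : P n -> N) :
  cohomologous f g -> cohomologous f' g' ->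
  cohomologous (fun x => f x + f' x) (fun x => g x + g' x).
Proof.
by move=> fg gh; apply: eq_cobound (coboundD fg gh) => x; rewrite opprD addrACA.
Qed.

Lemma cohomologous_sum n (I : Type) (r : seq I) (f g : I -> P n -> N) :
  (forall i, cohomologous (f i) (g i)) ->
  cohomologous (fun x => \sum_(i <- r) f i x) (fun x => \sum_(i <- r) g i x).
Proof.
move=> fg; elim: r => [|i r IH].
  by apply: eq_cohomologous => x; rewrite !big_nil.
have := cohomologousD (fg i) IH.
by apply: eq_cobound => x; rewrite !big_cons.
Qed.

Lemma cobound_cohomologous n (f g : P n -> N) :
  cohomologous f g -> cobound f -> cobound g.
Proof.
move=> /cohomologous_sym fg f0.
by apply: eq_cobound (coboundD fg f0) => x; rewrite subrK.
Qed.

Lemma cohomologous0 n (f : P n -> N) : cobound f -> cohomologous f (fun=> 0).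
Proof. by apply: eq_cobound => x; rewrite subr0. Qed.

End Cochains.

Section CochainComp.
Variables (R : pzRingType) (P : nat -> lmodType R).
Variable d : forall n, {linear P n.+1 -> P n}.
Variables (N N' : lmodType R) (h : {linear N -> N'}).

Lemma cobound_comp n (f : P n -> N) :
  cobound d f -> cobound d (fun x => h (f x)).
Proof.
case: n f => [|n] f /=; first by move=> f0 x; rewrite f0 linear0.
by move=> [u uE]; exists (h \o u) => x; rewrite uE.
Qed.

Lemma cohomologous_comp n (f g : P n -> N) :
  cohomologous d f g -> cohomologous d (fun x => h (f x)) (fun x => h (g x)).
Proof. by move=> /cobound_comp; apply: eq_cobound => x; rewrite linearB. Qed.

End CochainComp.

Section Comparison.
Variable R : pzRingType.

(** Projectivity lifts through surjections only; exactness makes [g] surjective onto [ker g'], and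
    [f] also lands there. *)
Lemma projective_lift (P B C D : lmodType R) (g : {linear B -> C})
    (g' : {linear C -> D}) (f : {linear P -> C}) :
  projective P -> (forall c, g' c = 0 -> exists b, g b = c) ->
  (forall b, g' (g b) = 0) ->
  (forall x, g' (f x) = 0) ->
  exists h : {linear P -> B}, forall x, g (h x) = f x.
Proof.
move=> Pproj ex gg' f0.
have gk b : g b \in kerp g' by apply/eqP.
have fk x : f x \in kerp g' by apply/eqP; exact: f0.
pose gK b := Ker (gk b); pose fK x := Ker (fk x).
have gKlin : linear gK.
  by move=> c x y; apply: val_inj; rewrite /= linearP.
have fKlin : linear fK.
  by move=> c x y; apply: val_inj; rewrite /= linearP.
pose gL : {linear B -> ker g'} := mklin gKlin.
pose fL : {linear P -> ker g'} := mklin fKlin.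
have [|h hE] := Pproj _ _ gL fL.
  move=> [c cK]; have [b bE] := ex c (eqP cK).
  by exists b; apply: val_inj.
by exists h => x; have /(congr1 val) := hE x.
Qed.

Variables (M : lmodType R) (P P' : nat -> lmodType R).
Variables (d : forall n, {linear P n.+1 -> P n}) (e : {linear P 0%N -> M}).
Variables (d' : forall n, {linear P' n.+1 -> P' n}) (e' : {linear P' 0%N -> M}).
Hypothesis Pproj : forall n, projective (P n).
Hypothesis Pex : exact_resolution d e.
Hypothesis P'ex : exact_resolution d' e'.

Lemma res_dd n x : d n (d n.+1 x) = 0.
Proof. by case: Pex => _ _ h; apply/h; exists x. Qed.

Lemma res_ed x : e (d 0 x) = 0.
Proof. by case: Pex => _ h _; apply/h; exists x. Qed.

(** Two consecutive components with their commuting square: the square is what allows the next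
    component to be lifted. Each step below reuses the upper component as the lower one, so the
    pairs agree by conversion and their squares are the chain map equations. *)
Let ladder n := {ab : {linear P n -> P' n} * {linear P n.+1 -> P' n.+1} |
  forall x, d' n (ab.2 x) = ab.1 (d n x)}.

Lemma ladder0 : exists l : ladder 0, forall x, e' ((sval l).1 x) = e x.
Proof.
have [surj ex0 exS] := P'ex.
have [a aE] := @Pproj 0%N _ _ e' e surj.
have [|||b bE] := @projective_lift _ _ _ _ (d' 0) e' (a \o d 0) (@Pproj 1%N).
- by move=> c /ex0.
- by move=> b; apply/ex0; exists b.
- by move=> x /=; rewrite [LHS](aE (d 0 x)) res_ed.
by exists (exist _ (a, b) bE) => x; exact: aE.
Qed.

Lemma ladderS n (l : ladder n) :
  exists c : {linear P n.+2 -> P' n.+2},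
    forall x, d' n.+1 (c x) = (sval l).2 (d n.+1 x).
Proof.
case: l => [[a b] /= ab]; have [surj ex0 exS] := P'ex.
have [|||c cE] := @projective_lift _ _ _ _ (d' n.+1) (d' n) (b \o d n.+1) (@Pproj n.+2).
- by move=> c /exS.
- by move=> y; apply/exS; exists y.
- by move=> x /=; rewrite ab res_dd linear0.
by exists c.
Qed.

Lemma comparison : exists a : forall n, {linear P n -> P' n},
  (forall x, e' (a 0%N x) = e x) /\
  forall n x, d' n (a n.+1 x) = a n (d n x).
Proof.
have [l0 l0E] := ladder0.
pose step n (l : ladder n) : ladder n.+1 :=
  exist _ ((sval l).2, sval (cid (ladderS l))) (svalP (cid (ladderS l))).
pose l := fix l n : ladder n := if n is m.+1 then step m (l m) else l0.
exists (fun n => (sval (l n)).1); split => // n x.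
exact: (svalP (l n)).
Qed.

(** A cocycle [f] kills the term d' t of a - b = d' t + s d, so the difference is the coboundary of
    f s. Hence one pair (s, t) per degree is enough, and no global homotopy is assembled. *)
Lemma chain_homotopy (a b : forall n, {linear P n -> P' n}) :
  (forall x, e' (a 0%N x) = e' (b 0%N x)) ->
  (forall n x, d' n (a n.+1 x) = a n (d n x)) ->
  (forall n x, d' n (b n.+1 x) = b n (d n x)) ->
  forall n (N : lmodType R) (f : {linear P' n -> N}),
    (forall x, f (d' n x) = 0) ->
    cohomologous d (fun x => f (a n x)) (fun x => f (b n x)).
Proof.
move=> ab0 aE bE.
have [surj ex0 exS] := P'ex.
have H0 : exists s : {linear P 0 -> P' 1}, forall x, d' 0 (s x) = a 0 x - b 0 x.
  apply: (@projective_lift _ _ _ _ (d' 0) e' (a 0 - b 0) (@Pproj 0%N)).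
  - by move=> c /ex0.
  - by move=> y; apply/ex0; exists y.
  - move=> x; rewrite [X in e' X](_ : _ = a 0 x - b 0 x) //.
    by rewrite linearB ab0 subrr.
have HS n : exists (s : {linear P n -> P' n.+1}) (t : {linear P n.+1 -> P' n.+2}),
    forall x, d' n.+1 (t x) = a n.+1 x - b n.+1 x - s (d n x).
  (* It is enough that [s] be a homotopy on the image of [d p]; there the correction term of the
     previous degree vanishes, because d d = 0. *)
  have lift p (s : {linear P p -> P' p.+1}) :
      (forall x, d' p (s (d p x)) = a p (d p x) - b p (d p x)) ->
      exists t : {linear P p.+1 -> P' p.+2},
        forall x, d' p.+1 (t x) = a p.+1 x - b p.+1 x - s (d p x).
    pose f : {linear P p.+1 -> P' p.+1} :=
      (a p.+1 \- b p.+1) \- (s \o d p).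
    have fE x : f x = a p.+1 x - b p.+1 x - s (d p x) by [].
    move=> sE; have [|||t tE] :=
      @projective_lift _ _ _ _ (d' p.+1) (d' p) f (@Pproj p.+1).
    - by move=> c /exS.
    - by move=> y; apply/exS; exists y.
    - by move=> x; rewrite fE !linearB aE bE sE subrr.
    by exists t => x; rewrite tE.
  elim: n => [|n [s [t tE]]].
    have [s sE] := H0; exists s; have [t tE] := lift 0%N s (fun x => sE (d 0 x)).
    by exists t.
  exists t; apply: lift => x.
  by rewrite tE res_dd linear0 subr0.
move=> n N f fd; case: n f fd => [|n] f fd.
  have [s sE] := H0 => x /=.
  by rewrite -linearB -sE fd.
have [s [t tE]] := HS n; exists (f \o s) => x /=.
by rewrite -linearB -[a _ _ - _](subrK (s (d n x))) -tE linearD fd add0r.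
Qed.

End Comparison.

(** * Restriction of scalars *)

Definition pullmod (R S : pzRingType) (f : {rmorphism R -> S})
  (M : lmodType S) : Type := M.

Section PullbackModule.
Variables (R S : pzRingType) (f : {rmorphism R -> S}).
Local Notation pullmod := (pullmod f).

Section Instance.
Variable M : lmodType S.
HB.instance Definition _ := GRing.Zmodule.copy (pullmod M) M.

Definition pull_act (r : R) (m : pullmod M) : pullmod M := f r *: (m : M).
Fact pull_actA r s m : pull_act r (pull_act s m) = pull_act (r * s) m.
Proof. by rewrite /pull_act scalerA rmorphM. Qed.
Fact pull_act1 : left_id 1 pull_act.
Proof. by move=> m; rewrite /pull_act rmorph1 scale1r. Qed.
Fact pull_actDr : right_distributive pull_act +%R.
Proof. by move=> r m n; rewrite /pull_act scalerDr. Qed.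
Fact pull_actDl m : {morph pull_act^~ m : r s / r + s}.
Proof. by move=> r s; rewrite /pull_act rmorphD scalerDl. Qed.
HB.instance Definition _ := GRing.Zmodule_isLmodule.Build R (pullmod M)
  pull_actA pull_act1 pull_actDr pull_actDl.

Lemma pull_scaleE (r : R) (m : pullmod M) : r *: m = f r *: (m : M).
Proof. by []. Qed.
End Instance.

Section Map.
Variables (M N : lmodType S) (g : {linear M -> N}).
Definition pull_map (x : pullmod M) : pullmod N := g x.
Fact pull_map_is_linear : linear pull_map.
Proof. by move=> r x y; rewrite /pull_map !pull_scaleE linearP. Qed.
HB.instance Definition _ := GRing.isLinear.Build R (pullmod M) (pullmod N) _
  pull_map pull_map_is_linear.
End Map.
End PullbackModule.

Arguments pull_map {R S} f {M N} g.

(** The underlying vector space of a module over a [k]-algebra; tensor products are formed over [k]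
    only. *)
Notation kmod M := (pullmod (in_alg _) M).

Lemma tmulBr (k : fieldType) (V W : lmodType k) (v : V) (w w' : W) :
  tmul v (w - w') = tmul v w - tmul v w'.
Proof. by rewrite tmulDr -scaleN1r tmulZr scaleN1r. Qed.

Lemma scale_bill (k : fieldType) (V : lmodType k) :
  bilinear_fun (fun (c : k^o) (v : V) => (c : k) *: v).
Proof.
split=> [v|w] c x y; first by rewrite scalerDr !scalerA mulrC.
by rewrite scalerDl scalerA.
Qed.

Lemma scale_bilr (k : fieldType) (V : lmodType k) :
  bilinear_fun (fun (v : V) (c : k^o) => (c : k) *: v).
Proof. by have [h1 h2] := scale_bill V; split. Qed.

Lemma mul_bil (k : fieldType) (A : algType k) : bilinear_fun (fun x y : A => x * y).
Proof.
by split=> [x|y] c u v; rewrite ?mulrDr ?mulrDl -?scalerAr -?scalerAl.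
Qed.

(** * Finite-rank projections and slices of tensors *)

Section TensorDecomposition.
Variables (k : fieldType) (V W : lmodType k).

Lemma tens_sum (t : V ⊗ W) :
  exists s : seq (V * W), t = \sum_(p <- s) tmul p.1 p.2.
Proof.
elim/tens_ind: t => [v w|t u [s ->] [s' ->]]; first by exists [:: (v, w)]; rewrite big_seq1.
by exists (s ++ s'); rewrite big_cat.
Qed.

(** By induction on the list: if p does not fix [w], then w - p w is a nonzero vector killed by p,
    and a rank-one term with this vector as image is added. *)
Lemma finite_projection (s : seq W) :
  exists r : seq (W * {linear W -> k^o}),
    let p w := \sum_(q <- r) (q.2 w : k) *: q.1 in
    (forall w, p (p w) = p w) /\ (forall w, w \in s -> p w = w).
Proof.
elim: s => [|w s [r /= [pp ps]]].
  by exists [::]; split=> [w|w]; rewrite ?big_nil.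
pose p w := \sum_(q <- r) (q.2 w : k) *: q.1.
have plin : linear p.
  move=> c x y; rewrite /p scaler_sumr -big_split; apply: eq_bigr => q _ /=.
  by rewrite linearP scalerDl scalerA.
pose pL : {linear W -> W} := mklin plin.
have [w0|w0] := eqVneq (w - p w) 0.
  exists r; split=> // x; rewrite inE => /orP[/eqP ->|/ps//].
  by apply/esym/eqP; rewrite -subr_eq0 -/(p w) w0.
have [mu [mulin mu1]] := exists_functional w0.
(* Subtracting mu p makes the functional vanish on the image of p while keeping the value 1 at w - p
   w; this keeps the enlarged map idempotent. *)
pose mu' : W -> k^o := fun x => mu x - mu (p x).
have mu'lin : linear mu'.
  by move=> c x y; rewrite /mu' plin !mulin scalerBr opprD addrACA.
pose muL : {linear W -> k^o} := @mklin _ W k^o _ mu'lin.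
have mu0 : mu 0 = 0.
  by have := mulin (-1) 0 0; rewrite scaler0 addr0 scaleN1r addNr.
have pw' : p (w - p w) = 0.
  by rewrite -[LHS]/(pL (w - p w)) linearB /= [p (p w)]pp subrr.
pose r' := (w - p w, muL) :: r; exists r'.
have p'E x : \sum_(q <- r') (q.2 x : k) *: q.1 = (mu' x : k) *: (w - p w) + p x.
  by rewrite /r' big_cons.
have p'w : (mu' (w - p w) : k) *: (w - p w) + p (w - p w) = w - p w.
  by rewrite /mu' pw' mu0 subr0 mu1 addr0 scale1r.
have p'p x : (mu' (p x) : k) *: (w - p w) + p (p x) = p x.
  by rewrite /mu' [p (p x)]pp subrr scale0r add0r.
have p'lin : linear (fun x => (mu' x : k) *: (w - p w) + p x).
  move=> c x y; move: (w - p w) => w'.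
  rewrite mu'lin plin scalerDl [c *: (_ *: w' + _)]scalerDr scalerA addrACA.
  exact: erefl.
pose p'L : {linear W -> W} := mklin p'lin.
have p'LE x : p'L x = (mu' x : k) *: (w - p w) + p x by [].
split=> [x|x]; rewrite /= !p'E -!p'LE.
  by rewrite [in RHS]p'LE [in LHS](p'LE x) linearD linearZ /= p'w p'p.
rewrite inE => /orP[/eqP ->|/ps px].
  by rewrite -[in LHS](subrK (p w) w) linearD /= p'w p'p subrK.
by rewrite -px -/(p x) p'LE p'p.
Qed.

Section Slice.
Variable l : {linear W -> k^o}.

Lemma slice_bil : bilinear_fun (fun (v : V) (w : W) => (l w : k) *: v).
Proof.
split=> [v|w] c x y; first by rewrite linearP scalerDl scalerA.
by rewrite scalerDr !scalerA mulrC.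
Qed.

Definition slice : V ⊗ W -> V := tens_lift (fun v w => (l w : k) *: v).
Fact slice_is_linear : linear slice.
Proof. exact: tens_lift_is_linear slice_bil. Qed.
HB.instance Definition _ := GRing.isLinear.Build k _ _ _ slice slice_is_linear.
Lemma sliceE v w : slice (tmul v w) = (l w : k) *: v.
Proof. by rewrite /slice tens_liftE //; exact: slice_bil. Qed.
End Slice.

Lemma tmul_suml (I : Type) (r : seq I) (F : I -> V) (w : W) :
  tmul (\sum_(i <- r) F i) w = \sum_(i <- r) tmul (F i) w.
Proof.
elim: r => [|i r IH]; last by rewrite !big_cons tmulDl IH.
by rewrite !big_nil -(scale0r (0 : V)) tmulZl scale0r.
Qed.

Lemma tmul_sumr (I : Type) (r : seq I) (F : I -> W) (v : V) :
  tmul v (\sum_(i <- r) F i) = \sum_(i <- r) tmul v (F i).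
Proof.
elim: r => [|i r IH]; last by rewrite !big_cons tmulDr IH.
by rewrite !big_nil -(scale0r (0 : W)) tmulZr scale0r.
Qed.

(** A substitute for a basis of [W]: the second legs of finitely many tensors form a finite list,
    and a finite-rank projection fixing that list rebuilds each tensor from its slices. *)
Lemma tens_slices (ts : seq (V ⊗ W)) :
  exists r : seq (W * {linear W -> k^o}),
    forall t, t \in ts -> t = \sum_(q <- r) tmul (slice q.2 t) q.1.
Proof.
have [s sP] : exists s : seq W, forall t, t \in ts ->
    exists2 u : seq (V * W), t = \sum_(p <- u) tmul p.1 p.2
      & {subset map snd u <= s}.
  elim: ts => [|t ts [s sP]]; first by exists [::].
  have [u uE] := tens_sum t; exists (map snd u ++ s) => t'.
  rewrite inE => /orP[/eqP ->|/sP [u' u'E us]].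
    by exists u => // x xu; rewrite mem_cat xu.
  by exists u' => // x /us xs; rewrite mem_cat xs orbT.
have [r /= [_ rs]] := finite_projection s; exists r => t /sP[u -> us].
under [RHS]eq_bigr => q _.
  rewrite linear_sum tmul_suml; under eq_bigr => p _ do rewrite /= sliceE tmulZl -tmulZr.
  over.
rewrite exchange_big /=; apply: eq_big_seq => p pu.
by rewrite -tmul_sumr rs //; apply: us; apply: map_f.
Qed.

End TensorDecomposition.

Section TensMapLinear.
Variables (k : fieldType) (V V' W W' : lmodType k).
Variables (f : {linear V -> V'}) (g : {linear W -> W'}).
Fact tens_map_is_linear : linear (tens_map f g).
Proof. exact: tens_lift_is_linear (tens_map_bil f g). Qed.
HB.instance Definition _ :=
  GRing.isLinear.Build k _ _ _ (tens_map f g) tens_map_is_linear.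
End TensMapLinear.

Section CochainPullback.
Variables (R S : pzRingType) (D : {rmorphism R -> S}).
Variables (P : nat -> lmodType R) (P' : nat -> lmodType S).
Variables (d : forall n, {linear P n.+1 -> P n}).
Variables (d' : forall n, {linear P' n.+1 -> P' n}).
Variable a : forall n, {linear P n -> pullmod D (P' n)}.
Hypothesis aE : forall n x, d' n (a n.+1 x) = a n (d n x).

Lemma cobound_pull (N : lmodType S) n (f : P' n -> N) :
  cobound d' f -> @cobound _ _ d (pullmod D N) n (fun x => f (a n x)).
Proof.
case: n f => [|n] f /=; first by move=> f0 x; exact: f0.
move=> [u uE]; exists (pull_map D u \o a n) => x /=.
by rewrite uE aE.
Qed.
End CochainPullback.

Section CochainPrecomp.
Variables (R : pzRingType) (P P' : nat -> lmodType R).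
Variables (d : forall n, {linear P n.+1 -> P n}).
Variables (d' : forall n, {linear P' n.+1 -> P' n}).
Variable a : forall n, {linear P n -> P' n}.
Hypothesis aE : forall n x, d' n (a n.+1 x) = a n (d n x).

Lemma cobound_precomp (N : lmodType R) n (f : P' n -> N) :
  cobound d' f -> cobound d (fun x => f (a n x)).
Proof.
case: n f => [|n] f /=; first by move=> f0 x; exact: f0.
by move=> [u uE]; exists (u \o a n) => x /=; rewrite uE aE.
Qed.
End CochainPrecomp.

Section KScale.
Variables (k : fieldType) (H : algType k) (Q : lmodType H).

Lemma kmod_scaleE (c : k) (q : kmod Q) : c *: q = (c%:A : H) *: (q : Q).
Proof. by []. Qed.

Lemma kmod_scaleAl (c : k) (h : H) (q : Q) :
  (c *: h) *: q = c *: (h *: q : kmod Q) :> kmod Q.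
Proof. by rewrite kmod_scaleE scalerA mulr_algl. Qed.

Lemma kmod_scaleAr (c : k) (h : H) (q : kmod Q) :
  h *: (c *: q : Q) = c *: (h *: (q : Q) : kmod Q) :> kmod Q.
Proof. by rewrite !kmod_scaleE !scalerA mulr_algl mulr_algr. Qed.

Lemma kmod_linearr (h : H) : linear (fun q : kmod Q => h *: (q : Q) : kmod Q).
Proof.
move=> c v w; rewrite -kmod_scaleAr.
exact: (@scalerDr H Q h (c *: v : kmod Q) w).
Qed.

Lemma kmod_linearl (q : Q) : linear (fun h : H => h *: q : kmod Q).
Proof. by move=> c v w; rewrite -kmod_scaleAl; exact: (@scalerDl H Q q (c *: v) w). Qed.

End KScale.

(** * Induction along D : H -> A^e *)

(* For A = C(X, Y) and H = C(X, X), [coact] is the comultiplication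
   a |-> a_1 ⊗ a_2 into H ⊗ A, [dmap] is h |-> h_1 ⊗ S(h_2), and [twist] is
   S_{Y,X} S_{X,Y}; the axioms are what is needed for M |-> M ⊗ A to be induction
   along [dmap], and for A^e to be free over H, on 1 ⊗ A. *)
Record galois_datum (k : fieldType) (H A : algType k)
    (eps : {lrmorphism H -> k^o}) := GaloisDatum {
  coact : {lrmorphism A -> H ⊗ A};
  dmap : {lrmorphism H -> envel A};
  coact_dmap : forall a, tens_lift (fun (h : H) (x : A) =>
    tmul 1 (x : A^c) * dmap h) (coact a) = tmul a 1;
  dmap_coact : forall h, tens_lift (fun (x : A) (y : A^c) =>
    coact x * tmul 1 (y : A)) (dmap h) = tmul h 1;
  dmap_act1 : forall h, bimod_act (dmap h) 1 = (eps h : k)%:A;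
  twist : {linear A -> A};
  coact_twist : forall a, tens_lift (fun (h : H) (x : A) =>
    dmap h * tmul 1 (twist x : A^c)) (coact a) = tmul a 1;
  dmap_twist : forall h, tens_lift (fun (x : A) (y : A^c) =>
    tmul 1 (y : A) * tens_map idfun twist (coact x)) (dmap h) = tmul h 1
}.

(* Q ⊗ A with the A^e-action a (q ⊗ x) b = a_1 q ⊗ a_2 x b. *)
Definition ind (k : fieldType) (H A : algType k) (eps : {lrmorphism H -> k^o})
  (G : galois_datum A eps) (Q : lmodType H) : Type := kmod Q ⊗ A.

Section Induction.
Variables (k : fieldType) (H A : algType k) (eps : {lrmorphism H -> k^o}).
Variable G : galois_datum A eps.
Let rho := coact G.
Let D := dmap G.

Section Module.
Variable Q : lmodType H.
Implicit Types (m : kmod Q ⊗ A) (u : H ⊗ A) (b : A).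

(* (h ⊗ y) . (q ⊗ x) . b = h q ⊗ y x b *)
Definition pact0 (h : H) (y b : A) m : kmod Q ⊗ A :=
  tens_lift (fun (q : kmod Q) (x : A) => tmul (h *: (q : Q) : kmod Q) (y * x * b)) m.

Lemma pact0_bil h y b :
  bilinear_fun (fun (q : kmod Q) (x : A) => tmul (h *: (q : Q) : kmod Q) (y * x * b)).
Proof.
split=> [q|x] c v w.
  by rewrite mulrDr -scalerAr mulrDl -scalerAl tmulDr tmulZr.
by rewrite kmod_linearr tmulDl tmulZl.
Qed.

Lemma pact0E h y b q x :
  pact0 h y b (tmul q x) = tmul (h *: (q : Q) : kmod Q) (y * x * b).
Proof. by rewrite /pact0 tens_liftE //; exact: pact0_bil. Qed.

Lemma pact0_linear h y b : linear (pact0 h y b).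
Proof. exact: tens_lift_is_linear (pact0_bil h y b). Qed.

Lemma pact0D h y b m m' : pact0 h y b (m + m') = pact0 h y b m + pact0 h y b m'.
Proof. exact: (linearD_fun (pact0_linear h y b)). Qed.

Definition pact u b m : kmod Q ⊗ A :=
  tens_lift (fun (h : H) (y : A) => pact0 h y b m) u.

Lemma pact_bil b m : bilinear_fun (fun (h : H) (y : A) => pact0 h y b m).
Proof.
split=> [h|y] c v w; elim/tens_ind: m => [q x|m m' IH IH'].
- by rewrite !pact0E !mulrDl tmulDr -!scalerAl tmulZr.
- by rewrite !pact0D IH IH' scalerDr addrACA.
- by rewrite !pact0E kmod_linearl tmulDl tmulZl.
- by rewrite !pact0D IH IH' scalerDr addrACA.
Qed.

Lemma pactE h y b m : pact (tmul h y) b m = pact0 h y b m.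
Proof. by rewrite /pact tens_liftE //; exact: pact_bil. Qed.

Lemma pact_linear b m : linear (fun u => pact u b m).
Proof. exact: tens_lift_is_linear (pact_bil b m). Qed.

Lemma pactDl b m u u' : pact (u + u') b m = pact u b m + pact u' b m.
Proof. exact: (linearD_fun (pact_linear b m)). Qed.

Lemma pactDr u b m m' : pact u b (m + m') = pact u b m + pact u b m'.
Proof.
elim/tens_ind: u => [h y|u u' IH IH']; first by rewrite !pactE pact0D.
by rewrite !pactDl IH IH' addrACA.
Qed.

Lemma pact_linearb u m : linear (fun b => pact u b m).
Proof.
move=> c v w; elim/tens_ind: u => [h y|u u' IH IH']; last first.
  by rewrite !pactDl IH IH' scalerDr addrACA.
rewrite !pactE; elim/tens_ind: m => [q x|m m' IH IH'].
  by rewrite !pact0E mulrDr -scalerAr tmulDr tmulZr.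
by rewrite !pact0D IH IH' scalerDr addrACA.
Qed.

Lemma pact_comp u u' b b' m : pact u b (pact u' b' m) = pact (u * u') (b' * b) m.
Proof.
elim/tens_ind: u => [h y|u v IH IH']; last by rewrite mulrDl !pactDl IH IH'.
elim/tens_ind: u' => [h' y'|u v IH IH']; last first.
  by rewrite mulrDr !pactDl pactDr IH IH'.
rewrite tmulM !pactE; elim/tens_ind: m => [q x|m m' IH IH'].
  by rewrite !pact0E scalerA !mulrA.
by rewrite !pact0D IH IH'.
Qed.

Lemma pact1 m : pact 1 1 m = m.
Proof.
rewrite pactE; elim/tens_ind: m => [q x|m m' IH IH'].
  by rewrite pact0E scale1r mul1r mulr1.
by rewrite pact0D IH IH'.
Qed.

Local Notation ind := (ind G Q).
HB.instance Definition _ := GRing.Zmodule.copy ind (kmod Q ⊗ A).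

Definition ind_act (t : envel A) (m : ind) : ind :=
  tens_lift (fun (a : A) (b : A^c) => pact (rho a) (b : A) m) t.

Lemma ind_act_bil (m : kmod Q ⊗ A) :
  bilinear_fun (fun (a : A) (b : A^c) => pact (rho a) (b : A) m).
Proof.
split=> [a|b] c x y; first exact: pact_linearb.
by rewrite linearP; exact: pact_linear.
Qed.

Lemma ind_actE (a : A) (b : A^c) (m : ind) :
  ind_act (tmul a b) m = pact (rho a) (b : A) m.
Proof. by rewrite /ind_act tens_liftE //; exact: ind_act_bil. Qed.

Fact ind_actDl (m : ind) : {morph ind_act^~ m : t u / t + u}.
Proof. exact: linearD_fun (tens_lift_is_linear (ind_act_bil m)). Qed.

Fact ind_actDr : right_distributive ind_act +%R.
Proof.
move=> t m n; elim/tens_ind: t => [a b|t u IH IH'].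
  by rewrite !ind_actE; exact: pactDr.
by rewrite !ind_actDl IH IH' addrACA.
Qed.

Fact ind_actA (t u : envel A) m : ind_act t (ind_act u m) = ind_act (t * u) m.
Proof.
elim/tens_ind: t => [a b|t t' IH IH']; last by rewrite mulrDl !ind_actDl IH IH'.
elim/tens_ind: u => [a' b'|u u' IH IH'].
  by rewrite tmulM !ind_actE pact_comp rmorphM.
by rewrite mulrDr !ind_actDl ind_actDr IH IH'.
Qed.

Fact ind_act1 : left_id 1 ind_act.
Proof. by move=> m; rewrite ind_actE rmorph1; exact: pact1. Qed.

HB.instance Definition _ := GRing.Zmodule_isLmodule.Build (envel A) ind
  ind_actA ind_act1 ind_actDr ind_actDl.

Lemma ind_scaleE (a : A) (b : A^c) (m : ind) :
  (tmul a b : envel A) *: m = pact (rho a) (b : A) m.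
Proof. exact: ind_actE. Qed.

Definition ind_unit (q : Q) : pullmod D ind := tmul (q : kmod Q) (1 : A).

(** The action on q ⊗ 1 depends on t only through its image under x ⊗ y |-> coact(x) (1 ⊗ y). For t
    = D(h) that image is h ⊗ 1 by [dmap_coact], which makes the unit H-linear. *)
Lemma ind_unit_act (t : envel A) (q : Q) :
  t *: (tmul (q : kmod Q) (1 : A) : ind) =
  tens_lift (fun (h : H) (x : A) => tmul (h *: q : kmod Q) x)
    (tens_lift (fun (x : A) (y : A^c) => rho x * tmul 1 (y : A)) t).
Proof.
have bil1 : bilinear_fun (fun (h : H) (x : A) => tmul (h *: q : kmod Q) x).
  split=> [h|x] c v w; first by rewrite tmulDr tmulZr.
  by rewrite kmod_linearl tmulDl tmulZl.
have bil2 : bilinear_fun (fun (x : A) (y : A^c) => rho x * tmul 1 (y : A)).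
  split=> [x|y] c v w; first by rewrite tmulDr tmulZr mulrDr -scalerAr.
  by rewrite linearP mulrDl -scalerAl.
have lin1 := linearD_fun (tens_lift_is_linear bil1).
elim/tens_ind: t => [a b|t t' IH IH']; last first.
  by rewrite scalerDl IH IH' (linearD_fun (tens_lift_is_linear bil2)) lin1.
rewrite ind_scaleE tens_liftE //; elim/tens_ind: (rho a) => [h y|u u' IH IH'].
  by rewrite tmulM pactE pact0E tens_liftE // !mulr1.
by rewrite pactDl IH IH' mulrDl lin1.
Qed.

Fact ind_unit_is_linear : linear ind_unit.
Proof.
move=> h q q'; rewrite /ind_unit pull_scaleE ind_unit_act dmap_coact.
rewrite tens_liftE; first by rewrite -tmulDl.
split=> [h'|x] c v w; first by rewrite tmulDr tmulZr.
by rewrite kmod_linearl tmulDl tmulZl.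
Qed.
HB.instance Definition _ := GRing.isLinear.Build H Q (pullmod D ind) _
  ind_unit ind_unit_is_linear.

Section Adjoint.
Variables (M : lmodType (envel A)) (g : {linear Q -> pullmod D M}).

(** The transpose of [g]; its value on q ⊗ x is forced, since q ⊗ x is 1 ⊗ x applied to the unit at
    q. *)
Definition ind_adj (m : ind) : M :=
  @tens_lift k (kmod Q) A (kmod M)
    (fun (q : kmod Q) (x : A) => (tmul 1 (x : A^c) : envel A) *: (g q : M)) m.

Lemma kmod_pull (c : k) (q : kmod Q) :
  g (c *: q : kmod Q) = c *: (g q : kmod M) :> M.
Proof.
rewrite -[LHS]/(g ((c%:A : H) *: (q : Q))) (linearZ_LR g).
by rewrite -[LHS]/(D (c%:A) *: (g q : M)) (linearZ_LR D) rmorph1.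
Qed.

Lemma ind_adj_bil : @bilinear_fun k (kmod Q) A (kmod M)
    (fun (q : kmod Q) (x : A) => (tmul 1 (x : A^c) : envel A) *: (g q : M)).
Proof.
split=> [q|x] c v w.
  by rewrite tmulDr tmulZr scalerDl kmod_scaleAl.
rewrite -[RHS]kmod_linearr -kmod_pull.
exact: (congr1 (fun m : M => (tmul 1 (x : A^c) : envel A) *: m)
  (linearD g (c *: v : kmod Q) w)).
Qed.

Lemma ind_adjE q x :
  ind_adj (tmul q x) = (tmul 1 (x : A^c) : envel A) *: (g q : M).
Proof. by rewrite /ind_adj tens_liftE //; exact: ind_adj_bil. Qed.

Lemma ind_adjD m m' : ind_adj (m + m') = ind_adj m + ind_adj m'.
Proof. exact: (linearD_fun (tens_lift_is_linear ind_adj_bil)). Qed.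

(** Isolates the expression in [u] that [coact_dmap] evaluates to a ⊗ 1 when u = coact(a); linearity
    of [ind_adj] over the left factor of A^e follows. *)
Lemma ind_adj_pact u b q x : ind_adj (pact u b (tmul q x)) =
  ((tmul 1 (x * b : A) : envel A) * tens_lift (fun (h : H) (x : A) =>
    tmul 1 (x : A^c) * D h) u) *: (g q : M).
Proof.
have bil : bilinear_fun (fun (h : H) (x : A) => tmul 1 (x : A^c) * D h).
  split=> [h|y] c v w; first by rewrite tmulDr tmulZr mulrDl -scalerAl.
  by rewrite linearP mulrDr -scalerAr.
elim/tens_ind: u => [h y|u u' IH IH']; last first.
  rewrite pactDl ind_adjD IH IH' (linearD_fun (tens_lift_is_linear bil)).
  by rewrite mulrDr scalerDl.
rewrite pactE pact0E ind_adjE tens_liftE // linearZ /= pull_scaleE scalerA.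
by rewrite mulrA tmulM mulr1 -[_ * _ * b]mulrA.
Qed.

Fact ind_adj_is_linear : linear ind_adj.
Proof.
move=> t m m'; rewrite ind_adjD; congr (_ + _).
elim/tens_ind: t => [a b|t t' IH IH']; last by rewrite !scalerDl ind_adjD IH IH'.
rewrite ind_scaleE; elim/tens_ind: m => [q x|m n IH IH'].
  rewrite ind_adj_pact coact_dmap ind_adjE scalerA !tmulM.
  by rewrite mulr1 mul1r mulr1.
by rewrite pactDr !ind_adjD IH IH' scalerDr.
Qed.
HB.instance Definition _ := GRing.isLinear.Build (envel A) ind M _
  ind_adj ind_adj_is_linear.

Lemma ind_adj_unit q : ind_adj (ind_unit q) = g q.
Proof. by rewrite ind_adjE scale1r. Qed.
End Adjoint.

Lemma ind_ext (M : lmodType (envel A)) (f g : {linear ind -> M}) :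
  (forall q, f (ind_unit q) = g (ind_unit q)) -> f =1 g.
Proof.
move=> fg; elim/tens_ind=> [q x|m m' IH IH']; last by rewrite !linearD IH IH'.
have -> : tmul q x = (tmul 1 (x : A^c) : envel A) *: (ind_unit q : ind).
  by rewrite ind_scaleE rmorph1 pactE pact0E scale1r mulr1 mul1r.
by rewrite !linearZ fg.
Qed.

(** A left adjoint preserves projectives when its right adjoint, here restriction along D, preserves
    surjections. *)
Lemma ind_projective : projective Q -> projective (ind : lmodType (envel A)).
Proof.
move=> Qproj B C g f gsurj.
pose f' : {linear Q -> pullmod D C} := pull_map D f \o ind_unit.
have [h hE] := Qproj _ _
  (pull_map D g : {linear pullmod D B -> pullmod D C}) f' gsurj.
exists (ind_adj h); apply: ind_ext => q /=.
by rewrite ind_adj_unit; exact: hE.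
Qed.
End Module.

Section Functor.
Variables (Q Q' : lmodType H) (f : {linear Q -> Q'}).
Definition ind_map : {linear ind G Q -> ind G Q'} :=
  ind_adj (@ind_unit Q' \o f : {linear Q -> pullmod D (ind G Q')}).

Lemma ind_map_unit q : ind_map (ind_unit q) = ind_unit (f q).
Proof. exact: ind_adj_unit. Qed.

Lemma ind_mapE (q : kmod Q) (x : A) :
  ind_map (tmul q x) = tmul (f q : kmod Q') x.
Proof.
rewrite /= ind_adjE ind_scaleE rmorph1 pactE pact0E.
by rewrite scale1r mulr1 mul1r.
Qed.
End Functor.

End Induction.

(** * Change of rings for Ext *)

Section BaseChange.
Variables (k : fieldType) (H A : algType k) (eps : {lrmorphism H -> k^o}).
Variable G : galois_datum A eps.
Let D := dmap G.

(** Induced maps touch the first factor only. Exactness of induction can therefore be checked slice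
    by slice: each slice is lifted over H, and the lifts are reassembled into a tensor. *)
Lemma slice_ind_map (Q Q' : lmodType H) (f : {linear Q -> Q'})
    (l : {linear A -> k^o}) (t : kmod Q ⊗ A) :
  slice l (ind_map G f t : kmod Q' ⊗ A) = f (slice l t) :> Q'.
Proof.
elim/tens_ind: t => [q x|t t' IH IH'].
  by rewrite ind_mapE !sliceE !kmod_scaleE (linearZ_LR f).
by rewrite !linearD /= IH IH' -linearD.
Qed.

Lemma ind_exact (Q Q' Q'' : lmodType H) (f : {linear Q -> Q'}) (g : {linear Q' -> Q''}) :
  (forall x, g x = 0 -> exists y, f y = x) ->
  forall t, ind_map G g t = 0 -> exists s, ind_map G f s = t.
Proof.
move=> ex t gt; have [r rP] := tens_slices [:: (t : kmod Q' ⊗ A)].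
have g0 (l : {linear A -> k^o}) : g (slice l (t : kmod Q' ⊗ A)) = 0.
  by rewrite -slice_ind_map gt linear0.
pose y l := sval (cid (ex _ (g0 l))).
have yE l : f (y l) = slice l (t : kmod Q' ⊗ A) by rewrite /y; case: cid.
exists (\sum_(q <- r) tmul (y q.2 : kmod Q) q.1).
rewrite [RHS]rP ?mem_head // linear_sum.
by apply: eq_bigr => q _; rewrite ind_mapE yE.
Qed.

Let Q n := fres (trivmod eps) n.
Let d n : {linear Q n.+1 -> Q n} := fres_d (trivmod eps) n.
Let e : {linear Q 0 -> trivmod eps} := fres_aug (trivmod eps).

(** The embedding of k into A is H-linear by [dmap_act1]: D(h) sends 1 to eps(h). Its transpose is
    the identification of k ⊗ A with A. *)
Definition base_aug0 (q : Q 0) : pullmod D (bimod A) := (e q : k)%:A.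
Fact base_aug0_is_linear : linear base_aug0.
Proof.
move=> h q q'; rewrite /base_aug0 linearP pull_scaleE.
rewrite -[X in _ = X + _]/(bimod_act (D h) (e q : k)%:A).
rewrite -[X in X%:A]/(eps h * (e q : k) + e q' :> k) scalerDl -scalerA.
congr (_ + _); rewrite scalerA mulrC -scalerA -(dmap_act1 G).
elim/tens_ind: (dmap G h) => [a b|t t' IH IH'].
  by rewrite !bimod_actE mulr1 -scalerAr mulr1 -scalerAl.
by rewrite !bimod_actDl scalerDr IH IH'.
Qed.
HB.instance Definition _ := GRing.isLinear.Build H (Q 0) (pullmod D (bimod A)) _
  base_aug0 base_aug0_is_linear.

Definition base_aug : {linear ind G (Q 0) -> bimod A} := ind_adj base_aug0.

Lemma base_augE (q : kmod (Q 0)) (x : A) : base_aug (tmul q x) = (e q : k) *: x.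
Proof.
rewrite /= ind_adjE -[LHS]/(bimod_act _ _) bimod_actE mul1r.
by rewrite mulr_algl.
Qed.

Lemma slice_base_aug (l : {linear A -> k^o}) (t : kmod (Q 0) ⊗ A) :
  l (base_aug t : A) = e (slice l t) :> k.
Proof.
elim/tens_ind: t => [q x|t t' IH IH']; last first.
  rewrite (linearD (slice l)) (linearD e) (linearD base_aug) (linearD l).
  exact: (congr2 +%R IH IH').
rewrite base_augE sliceE linearZ /= kmod_scaleE (linearZ_LR e).
rewrite -[RHS]/(eps (l x)%:A * e q) (linearZ_LR eps) rmorph1.
by rewrite -[X in _ = X * _]/((l x : k) * 1) mulr1 mulrC.
Qed.

Lemma ind_resolution : @exact_resolution _ _ (fun n => ind G (Q n))
  (fun n => ind_map G (d n)) base_aug.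
Proof.
have [esurj ex0 exS] := fres_exact (trivmod eps).
have dd n x : d n (d n.+1 x) = 0 by apply/exS; exists x.
have ed x : e (d 0 x) = 0 by apply/ex0; exists x.
split.
- move=> x; have [q qE] := esurj (1 : k).
  by exists (tmul (q : kmod (Q 0)) (x : A)); rewrite base_augE [e q]qE scale1r.
- move=> t; split=> [t0|[s <-]].
    have [r rP] := tens_slices [:: (t : kmod (Q 0) ⊗ A)].
    have g0 (l : {linear A -> k^o}) : e (slice l (t : kmod (Q 0) ⊗ A)) = 0.
      by rewrite -slice_base_aug t0 linear0.
    have y0 l := (ex0 _).1 (g0 l).
    pose y l := sval (cid (y0 l)).
    have yE l : d 0 (y l) = slice l (t : kmod (Q 0) ⊗ A) by rewrite /y; case: cid.
    exists (\sum_(q <- r) tmul (y q.2 : kmod (Q 1)) q.1).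
    rewrite [RHS]rP ?mem_head // linear_sum.
    by apply: eq_bigr => q _; rewrite ind_mapE yE.
  elim/tens_ind: s => [q x|s s' IH IH'].
    by rewrite ind_mapE base_augE ed scale0r.
  by rewrite !linearD IH IH' addr0.
- move=> n t; split; first by apply: ind_exact => x /exS.
  move=> [s <-]; elim/tens_ind: s => [q x|s s' IH IH'].
    by rewrite !ind_mapE dd -(scale0r (0 : kmod (Q n))) tmulZl scale0r.
  by rewrite !linearD IH IH' addr0.
Qed.

(* Ext_{A^e}(A, M) = Ext_H(k, M), realized by a chain map [iota] between the
   canonical resolutions, hence natural in M. *)
Lemma base_change : exists iota : forall n,
    {linear fres (trivmod eps) n -> pullmod D (fres (bimod A) n)},
  [/\ forall n x, fres_d (bimod A) n (iota n.+1 x) =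
        iota n (fres_d (trivmod eps) n x),
      forall n (M : lmodType (envel A)) (f : {linear fres (bimod A) n -> M}),
        (forall x, f (fres_d (bimod A) n x) = 0) ->
        @cobound _ _ (fres_d (trivmod eps)) (pullmod D M) n (fun x => f (iota n x)) ->
        cobound (fres_d (bimod A)) f,
      forall n (M : lmodType (envel A)) (f g : {linear fres (bimod A) n -> M}),
        (forall x, f (fres_d (bimod A) n x) = 0) ->
        (forall x, g (fres_d (bimod A) n x) = 0) ->
        @cohomologous _ _ (fres_d (trivmod eps)) (pullmod D M) n
          (fun x => f (iota n x)) (fun x => g (iota n x)) ->
        cohomologous (fres_d (bimod A)) f g
    & forall n (M : lmodType (envel A))
        (g : {linear fres (trivmod eps) n -> pullmod D M}),
        (forall x, g (fres_d (trivmod eps) n x) = 0) ->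
        exists f : {linear fres (bimod A) n -> M},
          (forall x, f (fres_d (bimod A) n x) = 0) /\
          @cohomologous _ _ (fres_d (trivmod eps)) (pullmod D M) n
             (fun x => f (iota n x)) g].
Proof.
pose F n : lmodType (envel A) := ind G (Q n).
pose dF n : {linear F n.+1 -> F n} := ind_map G (d n).
have Fproj n : projective (F n).
  by apply: ind_projective; exact: fres_projective.
have Fex : exact_resolution dF base_aug := ind_resolution.
have Rex := fres_exact (bimod A).
have Rproj n := @fres_projective _ (bimod A) n.
have [b [be bd]] := comparison Fproj Fex Rex.
have [a [ae ad]] := comparison Rproj Rex Fex.
pose iota n : {linear Q n -> pullmod D (fres (bimod A) n)} :=
  (pull_map D (b n) : {linear pullmod D (F n) -> pullmod D (fres (bimod A) n)})
  \o (@ind_unit _ _ _ _ G (Q n)).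
have iotaE n x : iota n x = b n (ind_unit G x) by [].
have unitd n x : dF n (ind_unit G x) = ind_unit G (d n x) by exact: ind_map_unit.
(* A primitive over H extends by adjunction to the induced resolution and is then pulled back along
   [a]; the composite b a is homotopic to the identity. *)
have iota_inj n (M : lmodType (envel A)) (f : {linear fres (bimod A) n -> M}) :
    (forall x, f (fres_d (bimod A) n x) = 0) ->
    @cobound _ _ (fres_d (trivmod eps)) (pullmod D M) n (fun x => f (iota n x)) ->
    cobound (fres_d (bimod A)) f.
  move=> fc fb.
  have : cobound dF (fun x => f (b n x)).
    case: n f fc fb => [|n] f fc /=.
      move=> f0 x; apply: (@ind_ext _ _ _ _ G (Q 0) M (f \o b 0) \0) => q /=.
      exact: f0.
    move=> [u uE]; exists (ind_adj u) => x.
    apply: (@ind_ext _ _ _ _ G (Q n.+1) M (f \o b n.+1) (ind_adj u \o dF n)) => q /=.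
    rewrite -[f _]/(f (iota n.+1 q)) uE.
    by rewrite -[RHS]/(ind_adj u (dF n (ind_unit G q))) unitd ind_adj_unit.
  move=> /(cobound_precomp ad); apply: cobound_cohomologous.
  apply: (@chain_homotopy _ _ _ _ _ _ _ _ Rproj Rex Rex
    (fun n => b n \o a n) (fun n => idfun) _ _ _ n M f fc) => [x|m x|//].
  + by rewrite -[LHS]/(fres_aug (bimod A) (b 0%N (a 0%N x))) be ae.
  + by rewrite -[LHS]/(fres_d (bimod A) m (b m.+1 (a m.+1 x))) bd ad.
exists iota; split=> [n x||n M f g fc gc fg|].
- by rewrite !iotaE bd unitd.
- exact: iota_inj.
- by apply: (iota_inj n M (f \- g)) => // x; rewrite /= fc gc subr0.
- move=> n M g gc; pose f : {linear fres (bimod A) n -> M} := ind_adj g \o a n.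
  have gF x : ind_adj g (dF n x) = 0.
    apply: (@ind_ext _ _ _ _ G (Q n.+1) M (ind_adj g \o dF n) \0) => q /=.
    by rewrite -[LHS]/(ind_adj g (dF n (ind_unit G q))) unitd ind_adj_unit gc.
  exists f; split; first by move=> x /=; rewrite -ad gF.
  have h : cohomologous dF (fun x => ind_adj g (a n (b n x))) (ind_adj g).
    apply: (@chain_homotopy _ _ _ _ _ _ _ _ Fproj Fex Fex
      (fun n => a n \o b n) (fun n => idfun) _ _ _ n M (ind_adj g) gF) => [x|m x|//].
    + by rewrite -[LHS]/(base_aug (a 0%N (b 0%N x))) ae be.
    + by rewrite -[LHS]/(dF m (a m.+1 (b m.+1 x))) ad bd.
  have := @cobound_pull _ _ D _ _ d dF (fun n => @ind_unit _ _ _ _ G (Q n)) unitd M n _ h.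
  by apply: eq_cobound => x /=; rewrite ind_adj_unit.
Qed.

End BaseChange.

(** * The bimodule Ext(A, A^e) *)

Section ExtCochains.
Variables (R : pzRingType) (n : nat) (M N : lmodType R).
Local Notation d := (fres_d M).

Lemma is_coboundaryE (f : {linear fres M n -> N}) :
  is_coboundary f <-> cobound d f.
Proof.
case: n f => [|p] f /=; split=> //; first by move=> ->.
by move=> f0; apply: linear_ext => x; rewrite f0.
Qed.

Definition cocycle_of (f : {linear fres M n -> N})
  (fc : forall x, f (d n x) = 0) : cocycle n M N := Cocycle (asboolT fc).

Lemma cocycleP (f : cocycle n M N) x : cocycle_val f (d n x) = 0.
Proof. by case: f => f /= /asboolP ->. Qed.

Lemma ext_class_eq (f g : cocycle n M N) :
  ext_class f = ext_class g <-> cohomologous d (cocycle_val f) (cocycle_val g).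
Proof. by rewrite ext_classP is_coboundaryE. Qed.

Lemma Ext_eq0 (f : {linear fres M n -> N}) :
  (forall x : Ext n M N, x = 0) -> (forall x, f (d n x) = 0) -> cobound d f.
Proof.
move=> E0 fc; have := E0 (ext_class (cocycle_of fc)).
rewrite -[RHS](E0 (ext_class 0)) => /ext_class_eq.
by apply: eq_cobound => x /=; rewrite subr0.
Qed.

End ExtCochains.

Section IntegralCocycle.
Variables (k : fieldType) (H : algType k) (eps xi : {lrmorphism H -> k^o}).
Variable n : nat.
Local Notation d := (fres_d (trivmod eps)).

(** The cocycle represents the preimage of 1 under phi. Although phi is only additive, scalars are
    under control: s acts as the element s 1 of H, where [xi] takes the value s. *)
Lemma integral_cocycle : left_homological_integral eps n xi ->
  exists c : {linear fres (trivmod eps) n -> H^o},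
  [/\ forall x, c (d n x) = 0,
      ~ cobound d c,
      forall h, cohomologous d (fun x => (c x : H) * h : H^o)
                               (fun x => (xi h : k) *: (c x : H) : H^o)
    & forall g : {linear fres (trivmod eps) n -> H^o},
        (forall x, g (d n x) = 0) ->
        exists s : k, cohomologous d g (fun x => s *: (c x : H) : H^o)].
Proof.
move=> [phi [phibij phiM]]; have phi_inj := bij_inj phibij.
have [psi phiK psiK] := phibij.
pose c := ext_repr (psi 1).
have cE : ext_class c = psi 1 := ext_reprK _.
have classM h : ext_ract (ext_class c) h = ext_class (cocycle_map (rmul h) c).
  by rewrite /ext_ract ext_mapE.
have phic h : phi (ext_class (cocycle_map (rmul h) c)) = xi h.
  by rewrite -classM phiM cE psiK mul1r.
have xiA (s : k) : xi s%:A = s by rewrite (linearZ_LR xi) rmorph1 -[LHS]/(s * 1) mulr1.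
have scaleE (s : k) x : (cocycle_val c x : H) * s%:A = s *: (cocycle_val c x : H).
  by rewrite mulr_algr.
exists (cocycle_val c); split.
- exact: cocycleP.
- move=> c0; have : ext_class c = ext_class 0.
    by apply/ext_class_eq; apply: eq_cobound c0 => x /=; rewrite subr0.
  move/(congr1 phi); rewrite cE psiK.
  have -> : ext_class (0 : cocycle n (trivmod eps) H^o) = 0.
    by rewrite /ext_class raddf0.
  by rewrite raddf0 => /eqP; rewrite oner_eq0.
- move=> h; have /phi_inj/ext_class_eq :
    phi (ext_class (cocycle_map (rmul h) c)) =
    phi (ext_class (cocycle_map (rmul (xi h : k)%:A) c)) by rewrite !phic xiA.
  by apply: eq_cobound => x /=; rewrite -scaleE.
- move=> g gc; pose s := phi (ext_class (cocycle_of gc)); exists s.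
  have /phi_inj/ext_class_eq : phi (ext_class (cocycle_of gc)) =
    phi (ext_class (cocycle_map (rmul s%:A) c)) by rewrite phic xiA.
  by apply: eq_cobound => x /=; rewrite -scaleE.
Qed.
End IntegralCocycle.

Section LeftFactorModule.
Variables (k : fieldType) (H A : algType k).

(* The left H-module H ⊗ A, free on a basis of A. *)
Definition lfree : Type := H ⊗ A.
HB.instance Definition _ := GRing.Zmodule.copy lfree (H ⊗ A).

Definition lfree_act (h : H) (t : lfree) : lfree := tmul h 1 * (t : H ⊗ A).
Fact lfree_actA g h t : lfree_act g (lfree_act h t) = lfree_act (g * h) t.
Proof. by rewrite /lfree_act mulrA tmulM mulr1. Qed.
Fact lfree_act1 : left_id 1 lfree_act.
Proof. by move=> t; exact: mul1r. Qed.
Fact lfree_actDr : right_distributive lfree_act +%R.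
Proof. by move=> h t u; exact: mulrDr. Qed.
Fact lfree_actDl t : {morph lfree_act^~ t : g h / g + h}.
Proof. by move=> g h; rewrite /lfree_act tmulDl; exact: mulrDl. Qed.
HB.instance Definition _ := GRing.Zmodule_isLmodule.Build H lfree
  lfree_actA lfree_act1 lfree_actDr lfree_actDl.

Lemma lfree_scaleE (h x : H) (a : A) :
  h *: (tmul x a : lfree) = tmul (h * x) a :> H ⊗ A.
Proof. by rewrite -[LHS]/(tmul h 1 * tmul x a) tmulM mul1r. Qed.

Fact lfree_in_is_linear (a : A) : linear (fun x : H^o => tmul (x : H) a : lfree).
Proof. by move=> h x y; rewrite lfree_scaleE -tmulDl. Qed.
Definition lfree_in (a : A) : {linear H^o -> lfree} :=
  @mklin H H^o lfree _ (lfree_in_is_linear a).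

Fact lfree_slice_is_linear (l : {linear A -> k^o}) :
  linear (fun t : lfree => slice l (t : H ⊗ A) : H^o).
Proof.
move=> h t u; rewrite linearD; congr (_ + _).
elim/tens_ind: t => [x a|t t' IH IH'].
  by rewrite lfree_scaleE /= !sliceE -[RHS]/(h * (_ *: x)) -scalerAr.
by rewrite scalerDr !linearD /= IH IH' -[RHS]/(h * (_ + _)) mulrDr.
Qed.
Definition lfree_slice (l : {linear A -> k^o}) : {linear lfree -> H^o} :=
  @mklin H lfree H^o _ (lfree_slice_is_linear l).

End LeftFactorModule.
Arguments lfree_in {k H A} a.
Arguments lfree_slice {k H A} l.

Section RightTrivialization.
Variables (k : fieldType) (H : algType k) (eps : {lrmorphism H -> k^o}).

(** For Y = X this is an algebra retraction of D, since h_1 eps(S(h_2)) = h. Restriction along it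
    gives an H-module the trivial right action. *)
Definition rtriv (t : envel H) : H :=
  tens_lift (fun (h : H) (h' : H^c) => (eps h' : k) *: h) t.

Lemma rtriv_bil : bilinear_fun (fun (h : H) (h' : H^c) => (eps h' : k) *: h).
Proof.
split=> [h|h'] c x y; last by rewrite scalerDr !scalerA mulrC.
rewrite -[eps _]/(eps (c *: (x : H) + (y : H))) linearP.
by rewrite -[X in X *: h]/(c * eps x + eps y) scalerDl scalerA.
Qed.

Lemma rtrivE (h : H) (h' : H^c) : rtriv (tmul h h') = (eps h' : k) *: h.
Proof. by rewrite /rtriv tens_liftE //; exact: rtriv_bil. Qed.

Fact rtriv_is_linear : linear rtriv.
Proof. exact: tens_lift_is_linear rtriv_bil. Qed.
HB.instance Definition _ := GRing.isLinear.Build k (envel H) H _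
  rtriv rtriv_is_linear.

Fact rtriv_multiplicative : monoid_morphism rtriv.
Proof.
split=> [|t u]; first by rewrite rtrivE rmorph1 scale1r.
elim/tens_ind: t => [a b|t t' IH IH']; last by rewrite mulrDl !linearD /= IH IH' mulrDl.
elim/tens_ind: u => [a' b'|u u' IH IH']; last by rewrite mulrDr !linearD /= IH IH' mulrDr.
rewrite tmulM !rtrivE -scalerAl -scalerAr scalerA.
by rewrite -[eps (b * b')]/(eps ((b' : H) * (b : H))) rmorphM mulrC.
Qed.
HB.instance Definition _ := GRing.isMonoidMorphism.Build (envel H) H
  rtriv rtriv_multiplicative.
End RightTrivialization.

Section LinearSum.
Variables (R : pzRingType) (M N : lmodType R) (I : Type) (r : seq I).
Variable F : I -> {linear M -> N}.

Definition lin_sum (x : M) : N := \sum_(i <- r) F i x.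
Fact lin_sum_is_linear : linear lin_sum.
Proof.
move=> c x y; rewrite /lin_sum scaler_sumr -big_split.
by apply: eq_bigr => i _; rewrite linearP.
Qed.
HB.instance Definition _ := GRing.isLinear.Build R M N _ lin_sum lin_sum_is_linear.

Lemma linear_comb (f : {linear M -> N}) m (c : 'I_m -> R) (y : 'I_m -> M) :
  f (\sum_i c i *: y i) = \sum_i c i *: f (y i).
Proof. by rewrite linear_sum; apply: eq_bigr => i _; rewrite linearZ. Qed.
End LinearSum.

(** * Cocycles with finitely generated image *)

Section FinitelyGeneratedImage.
Variables (R S : pzRingType) (D : {rmorphism R -> S}) (p : {rmorphism S -> R}).
Hypothesis pD : forall r, p (D r) = r.

Section Retract.
Variable N : lmodType R.
(** Restricting along both maps gives back the action on [N], but only up to the equation [pD];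
    hence explicit identity maps in both directions. *)
Definition unpull (x : pullmod D (pullmod p N)) : N := x.
Fact unpull_is_linear : linear unpull.
Proof. by move=> h x y; rewrite /unpull !pull_scaleE pD. Qed.
HB.instance Definition _ := GRing.isLinear.Build R _ N _ unpull unpull_is_linear.

Definition repull (x : N) : pullmod D (pullmod p N) := x.
Fact repull_is_linear : linear repull.
Proof. by move=> h x y; rewrite /repull !pull_scaleE pD. Qed.
HB.instance Definition _ := GRing.isLinear.Build R N _ _ repull repull_is_linear.
End Retract.

Variables (K : lmodType R) (M : lmodType S).
Variable iota : forall n, {linear fres K n -> pullmod D (fres M n)}.
Hypothesis iotad : forall n x, fres_d M n (iota n.+1 x) = iota n (fres_d K n x).
Hypothesis iota_surj : forall n (N : lmodType S)
  (g : {linear fres K n -> pullmod D N}),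
  (forall x, g (fres_d K n x) = 0) ->
  exists f : {linear fres M n -> N}, (forall x, f (fres_d M n x) = 0) /\
    @cohomologous _ _ (fres_d K) (pullmod D N) n (fun x => f (iota n x)) g.
Hypothesis fgM : has_bounded_fgproj_resolution M.

(** Through the retraction [p], the cocycle extends to one over [S]. There it factors, up to
    coboundary, through a finitely generated term of the given resolution; restricting back, the
    images of its generators span all values. *)
Lemma cocycle_fg_image (N : lmodType R) n (g : {linear fres K n -> N}) :
  (forall x, g (fres_d K n x) = 0) ->
  exists g' : {linear fres K n -> N},
  [/\ forall x, g' (fres_d K n x) = 0,
      cohomologous (fres_d K) g g'
    & exists (m : nat) (y : 'I_m -> N),
        forall x, exists c : 'I_m -> R, g' x = \sum_i c i *: y i].
Proof.
move=> gc.
pose gT : {linear fres K n -> pullmod D (pullmod p N)} := @repull N \o g.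
have [//|f [fc fg]] := @iota_surj n (pullmod p N) gT.
have [P [dP [eP [Pex Pfg _]]]] := fgM.
have Rex := fres_exact M.
have Rproj m := @fres_projective _ M m.
have Pproj m := (Pfg m).1.
have [b [be bd]] := comparison Pproj Pex Rex.
have [a [ae ad]] := comparison Rproj Rex Pex.
have ff' : cohomologous (fres_d M) f (fun x => f (b n (a n x))).
  apply: cohomologous_sym.
  apply: (@chain_homotopy _ _ _ _ _ _ _ _ Rproj Rex Rex
    (fun n => b n \o a n) (fun n => idfun) _ _ _ n _ f fc) => [x|m x|//].
  + by rewrite -[LHS]/(fres_aug M (b 0%N (a 0%N x))) be ae.
  + by rewrite -[LHS]/(fres_d M m (b m.+1 (a m.+1 x))) bd ad.
pose fba : {linear fres M n -> pullmod p N} := f \o b n \o a n.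
pose h : {linear fres K n -> N} := @unpull N \o (pull_map D fba \o iota n).
have hE x : h x = f (b n (a n (iota n x))) by [].
exists h; split.
- by move=> x; rewrite hE -iotad -ad -bd fc.
- have gfi : cohomologous (fres_d K) g (fun x => f (iota n x) : N).
    have := cobound_comp (@unpull N) (cohomologous_sym fg).
    by apply: eq_cobound => x; rewrite linearB.
  apply: cohomologous_trans gfi _.
  have := cobound_pull iotad ff'.
  by move/(cobound_comp (@unpull N)); apply: eq_cobound.
- have [m [e eE]] := (Pfg n).2; exists m, (fun i => f (b n (e i))) => x.
  have [c cE] := eE (a n (iota n x)); exists (fun i => p (c i)).
  rewrite hE cE !linear_sum; apply: eq_bigr => i _.
  by rewrite !linearZ.
Qed.

End FinitelyGeneratedImage.

Section Generator.
Variables (k : fieldType) (H A : algType k) (eps : {lrmorphism H -> k^o}).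
Variables (GH : galois_datum H eps) (G : galois_datum A eps).
Hypothesis GH_rtriv : forall h, rtriv eps (dmap GH h) = h.
Local Notation d := (fres_d (trivmod eps)).
Local Notation Ae := (envel A).

Hypothesis fgH : has_bounded_fgproj_resolution (bimod H : lmodType (envel H)).

(** Surjectivity of Ext_H(k, H) ⊗ A -> Ext_H(k, H ⊗ A). Once the values lie in the H-span of
    finitely many tensors, the H-linear projection built from slices of those tensors fixes every
    value. *)
Lemma cocycle_slices n (g : {linear fres (trivmod eps) n -> lfree H A}) :
  (forall x, g (d n x) = 0) ->
  exists (r : seq (A * {linear A -> k^o}))
    (c : {linear A -> k^o} -> {linear fres (trivmod eps) n -> H^o}),
    (forall l x, c l (d n x) = 0) /\
    cohomologous d g (fun x => \sum_(q <- r) lfree_in q.1 (c q.2 x)).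
Proof.
move=> gc; have [iota [iotad _ _ iota_surj]] := base_change GH.
have [h [hc gh [m [y yE]]]] :=
  cocycle_fg_image GH_rtriv iotad iota_surj fgH gc.
have [r rP] := tens_slices [seq (y i : H ⊗ A) | i <- enum 'I_m].
exists r, (fun l => lfree_slice l \o h); split=> [l x|].
  by rewrite /= hc linear0.
pose proj : {linear lfree H A -> lfree H A} :=
  lin_sum r (fun q => @lfree_in k H A q.1 \o @lfree_slice k H A q.2).
apply: cohomologous_trans gh (eq_cohomologous _ _) => x.
have [c hx] := yE x.
have -> : h x = proj (h x).
  rewrite hx (linear_comb proj); apply: eq_bigr => i _; congr (_ *: _).
  by apply: rP; apply: map_f; rewrite mem_enum.
by [].
Qed.

(* [theta] and [kappa] are the inverse isomorphisms h ⊗ a |-> h_1 ⊗ a S(h_2) and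
   x ⊗ y |-> x_1 ⊗ y twist(x_2) between H ⊗ A and the left H-module A^e. *)
Definition theta (t : lfree H A) : pullmod (dmap G) Ae^o :=
  tens_lift (fun (h : H) (a : A) => dmap G h * tmul 1 (a : A^c)) t.

Lemma theta_bil : bilinear_fun (fun (h : H) (a : A) =>
  dmap G h * tmul 1 (a : A^c)).
Proof.
split=> [h|a] c v w; first by rewrite tmulDr tmulZr mulrDr -scalerAr.
by rewrite linearP mulrDl -scalerAl.
Qed.

Lemma thetaE (h : H) (a : A) : theta (tmul h a) = dmap G h * tmul 1 (a : A^c) :> Ae.
Proof. by rewrite /theta tens_liftE //; exact: theta_bil. Qed.

Lemma thetaD t t' : theta (t + t') = theta t + theta t'.
Proof. exact: (linearD_fun (tens_lift_is_linear theta_bil)). Qed.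

Fact theta_is_linear : linear theta.
Proof.
move=> h t u; rewrite thetaD; congr (_ + _).
elim/tens_ind: t => [x a|t t' IH IH'].
  by rewrite lfree_scaleE !thetaE rmorphM -mulrA.
by rewrite scalerDr !thetaD scalerDr IH IH'.
Qed.
Definition thetaL : {linear lfree H A -> pullmod (dmap G) Ae^o} :=
  mklin theta_is_linear.

Definition kappa (t : pullmod (dmap G) Ae^o) : lfree H A :=
  tens_lift (fun (x : A) (y : A^c) =>
    tmul 1 (y : A) * tens_map idfun (twist G) (coact G x)) t.

Lemma kappa_bil : bilinear_fun (fun (x : A) (y : A^c) =>
  tmul 1 (y : A) * tens_map idfun (twist G) (coact G x)).
Proof.
split=> [x|y] c v w; first by rewrite tmulDr tmulZr mulrDl -scalerAl.
by rewrite !linearP mulrDr -scalerAr.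
Qed.

Lemma kappaE (x : A) (y : A^c) : kappa (tmul x y) =
  tmul 1 (y : A) * tens_map idfun (twist G) (coact G x) :> H ⊗ A.
Proof. by rewrite /kappa tens_liftE //; exact: kappa_bil. Qed.

Lemma kappaD t t' : kappa (t + t') = kappa t + kappa t'.
Proof. exact: (linearD_fun (tens_lift_is_linear kappa_bil)). Qed.

Lemma kappa_mulr (t : Ae) (a : A) :
  kappa (t * tmul 1 (a : A^c)) = tmul 1 a * kappa t :> H ⊗ A.
Proof.
elim/tens_ind: t => [x y|t t' IH IH']; last by rewrite mulrDl !kappaD IH IH' mulrDr.
by rewrite tmulM !kappaE mulrA tmulM !mulr1.
Qed.

Lemma theta_mull (t : H ⊗ A) (a : A) :
  theta (tmul 1 a * t) = (theta t : Ae) * tmul 1 (a : A^c).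
Proof.
elim/tens_ind: t => [x y|t t' IH IH']; last by rewrite mulrDr !thetaD IH IH' mulrDl.
by rewrite tmulM !thetaE -mulrA tmulM !mul1r.
Qed.

Lemma theta_twist (u : H ⊗ A) : theta (tens_map idfun (twist G) u) =
  tens_lift (fun (h : H) (x : A) => dmap G h * tmul 1 (twist G x : A^c)) u.
Proof.
have bil : bilinear_fun (fun (h : H) (x : A) =>
    dmap G h * tmul 1 (twist G x : A^c)).
  by split=> [h|x] c v w;
    rewrite !linearP ?tmulDr ?tmulZr (mulrDr, mulrDl) -?scalerAr -?scalerAl.
elim/tens_ind: u => [h x|u u' IH IH']; first by rewrite tens_mapE thetaE tens_liftE.
by rewrite linearD thetaD IH IH' (linearD_fun (tens_lift_is_linear bil)).
Qed.

(** With the factor from A^op pulled out, this is [coact_twist]; the other composite is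
    [dmap_twist]. *)
Lemma kappaK : cancel kappa theta.
Proof.
elim/tens_ind=> [x y|t t' IH IH']; last by rewrite kappaD thetaD IH IH'.
rewrite kappaE theta_mull theta_twist coact_twist tmulM mulr1.
by congr tmul; exact: mul1r.
Qed.

Lemma thetaK : cancel theta kappa.
Proof.
elim/tens_ind=> [h a|t t' IH IH']; last by rewrite thetaD kappaD IH IH'.
by rewrite thetaE kappa_mulr [kappa _]dmap_twist tmulM mul1r mulr1.
Qed.

Fact kappa_is_linear : linear kappa.
Proof. by move=> h t u; apply: (can_inj thetaK); rewrite kappaK theta_is_linear !kappaK. Qed.
Definition kappaL : {linear pullmod (dmap G) Ae^o -> lfree H A} :=
  mklin kappa_is_linear.
End Generator.
Arguments theta {k H A eps} G t.
Arguments kappa {k H A eps} G t.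
Arguments thetaL {k H A eps} G.
Arguments kappaL {k H A eps} G.

Section DmapLinear.
Variables (k : fieldType) (H A : algType k) (eps : {lrmorphism H -> k^o}).
Variable G : galois_datum A eps.
Fact dmap_is_linear :
  linear (dmap G : H^o -> pullmod (dmap G) (envel A)^o).
Proof. by move=> h x y; rewrite rmorphD -[h *: x]/(h * (x : H)) rmorphM. Qed.
Definition dmapL : {linear H^o -> pullmod (dmap G) (envel A)^o} :=
  mklin dmap_is_linear.
End DmapLinear.
Arguments dmapL {k H A eps} G.

Section TrivialExtVanishing.
Variables (k : fieldType) (H : algType k) (eps : {lrmorphism H -> k^o}).
Variable GH : galois_datum H eps.
Hypothesis GH_rtriv : forall h, rtriv eps (dmap GH h) = h.

Fact rtrivL_is_linear :
  linear (rtriv eps : pullmod (dmap GH) (envel H)^o -> H^o).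
Proof.
move=> h x y; rewrite -[X in rtriv eps X]/(dmap GH h * (x : envel H) + (y : envel H)).
by rewrite rmorphD rmorphM /= GH_rtriv.
Qed.
Definition rtrivL : {linear pullmod (dmap GH) (envel H)^o -> H^o} :=
  mklin rtrivL_is_linear.

(** D carries the cocycle to one with values in H^e, where base change and the hypothesis make it a
    coboundary; the retraction [rtriv] then recovers [g]. *)
Lemma triv_ext_vanish n (g : {linear fres (trivmod eps) n -> H^o}) :
  (forall x : Ext n (bimod H) (envel H)^o, x = 0) ->
  (forall x, g (fres_d (trivmod eps) n x) = 0) ->
  cobound (fres_d (trivmod eps)) g.
Proof.
move=> E0 gc; have [iota [iotad _ _ iota_surj]] := base_change GH.
have [|f [fc fg]] := iota_surj n (envel H)^o (dmapL GH \o g).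
  by move=> x; rewrite -[LHS]/(dmapL GH (g _)) gc linear0.
have := cobound_pull iotad (Ext_eq0 E0 fc).
move/(cobound_cohomologous fg)/(cobound_comp rtrivL).
by apply: eq_cobound => x; exact: GH_rtriv.
Qed.
End TrivialExtVanishing.

(** * Comparison of free generators of Ext *)

Section FreeGenerators.
Variables (k : fieldType) (A : algType k) (n : nat).
Local Notation Ae := (envel A).
Local Notation d := (fres_d (bimod A)).
Local Notation cochain := ({linear fres (bimod A) n -> Ae^o}).
Local Notation "f ≈ g" := (@cohomologous _ _ d Ae^o n f g) (at level 70).

(* The class of c is a basis of the left A-module Ext^n(A, A^e), on which right
   multiplication by b acts through nu. *)
Definition free_generator (nu : A -> A) (c : cochain) :=
  [/\ forall x, c (d n x) = 0,
      forall a : A, cobound d (fun x => (c x : Ae) * tmul 1 (a : A^c) : Ae^o) -> a = 0,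
      forall f : cochain, (forall x, f (d n x) = 0) ->
        exists a : A, f ≈ (fun x => (c x : Ae) * tmul 1 (a : A^c))
    & forall b : A, (fun x => (c x : Ae) * tmul b (1 : A^c)) ≈
                    (fun x => (c x : Ae) * tmul 1 (nu b : A^c))].

Lemma cohomologous_mulr (f g : fres (bimod A) n -> Ae^o) (t : Ae) :
  f ≈ g -> (fun x => (f x : Ae) * t) ≈ (fun x => (g x : Ae) * t).
Proof. by move=> fg; have := cohomologous_comp (rmul t) fg; apply: eq_cobound. Qed.

Lemma free_generator_inj nu c (a a' : A) : free_generator nu c ->
  (fun x => (c x : Ae) * tmul 1 (a : A^c)) ≈ (fun x => (c x : Ae) * tmul 1 (a' : A^c)) ->
  a = a'.
Proof.
move=> [_ inj _ _] h; apply/eqP; rewrite -subr_eq0; apply/eqP/inj.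
apply: eq_cobound h => x; rewrite -mulrBr; congr (_ * _).
by apply/esym; exact: (@tmulBr k A A^c).
Qed.

Lemma mul_tmul1 (x : Ae) (a b : A) :
  x * tmul 1 (a : A^c) * tmul 1 (b : A^c) = x * tmul 1 (b * a : A).
Proof. by rewrite -mulrA tmulM mulr1. Qed.

(** Each generator is a multiple of the other, and freeness makes the two coefficients mutually
    inverse. *)
Lemma free_generator_twist nu nu' c c' :
  free_generator nu c -> free_generator nu' c' ->
  exists u v : A, [/\ u * v = 1, v * u = 1 & forall b, nu b = v * nu' b * u].
Proof.
move=> gc gc'; have [cc ci cg cn] := gc; have [cc' ci' cg' cn'] := gc'.
have [u cu] := cg _ cc'; have [v cv] := cg' _ cc.
have E t t' (f f' : fres (bimod A) n -> Ae^o) : f ≈ f' -> t = t' ->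
    (fun x => (f x : Ae) * t) ≈ (fun x => (f' x : Ae) * t').
  by move=> ff' <-; exact: cohomologous_mulr.
have R (f : cochain) : f ≈ (fun x => (f x : Ae) * tmul 1 (1 : A^c)).
  by apply: eq_cohomologous => x; exact/esym/mulr1.
have M (f : cochain) (a b : A) :
    (fun x => (f x : Ae) * tmul 1 (a : A^c) * tmul 1 (b : A^c)) ≈
    (fun x => (f x : Ae) * tmul 1 (b * a : A)).
  by apply: eq_cohomologous => x; rewrite mul_tmul1.
have vu1 : v * u = 1.
  apply: (free_generator_inj gc).
  apply: (cohomologous_trans (cohomologous_sym (M c u v))).
  apply: (cohomologous_trans (E _ _ _ _ (cohomologous_sym cu) erefl)).
  exact: (cohomologous_trans (cohomologous_sym cv) (R c)).
have uv1 : u * v = 1.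
  apply: (free_generator_inj gc').
  apply: (cohomologous_trans (cohomologous_sym (M c' v u))).
  apply: (cohomologous_trans (E _ _ _ _ (cohomologous_sym cv) erefl)).
  exact: (cohomologous_trans (cohomologous_sym cu) (R c')).
exists u, v; split=> // b.
(* The elements b ⊗ 1 and 1 ⊗ u commute, so c (b ⊗ 1) (1 ⊗ u) ~ c' (b ⊗ 1). Both sides are its
   coefficient with respect to c; products are reversed in the factor A^op. *)
suff h : u * nu b = nu' b * u by rewrite -mulrA -h mulrA vu1 mul1r.
apply: (free_generator_inj gc).
apply: (cohomologous_trans (cohomologous_sym (M c (nu b) u))).
apply: (cohomologous_trans (E _ _ _ _ (cohomologous_sym (cn b)) erefl)).
apply: cohomologous_sym.
apply: (cohomologous_trans (cohomologous_sym (M c u (nu' b)))).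
apply: (cohomologous_trans (E _ _ _ _ (cohomologous_sym cu) erefl)).
apply: (cohomologous_trans (cohomologous_sym (cn' b))).
apply: (cohomologous_trans (E _ _ _ _ cu erefl)).
apply: eq_cohomologous => x; rewrite -!mulrA !tmulM mulr1 mul1r.
by congr (_ * tmul _ _); [exact: esym (mulr1 b) | exact: esym (@mul1r A^c u)].
Qed.
End FreeGenerators.

Section ExtTwisted.
Variables (k : fieldType) (H A : algType k) (eps : {lrmorphism H -> k^o}).
Variables (GH : galois_datum H eps) (G : galois_datum A eps).
Hypothesis GH_rtriv : forall h, rtriv eps (dmap GH h) = h.
Variable n0 : nat.
Hypothesis H_tcy : twisted_calabi_yau H n0.
Variable xi : {lrmorphism H -> k^o}.
Hypothesis xi_int : left_homological_integral eps n0 xi.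

Local Notation dk := (fres_d (trivmod eps)).
Local Notation dA := (fres_d (bimod A)).
Local Notation D := (dmap G).
Local Notation Ae := (envel A).

(** xi(b_1) T(b_2), the abstract form of T [xi]^l; it plays the role of mu in Ext^d(A, A^e) =
    A^mu. *)
Definition nakayama (b : A) : A :=
  tens_lift (fun (h : H) (x : A) => (xi h : k) *: twist G x) (coact G b).

Lemma ext_twisted :
  (forall n, n <> n0 -> forall f : {linear fres (bimod A) n -> Ae^o},
     (forall x, f (dA n x) = 0) -> cobound dA f) /\
  exists c : {linear fres (bimod A) n0 -> Ae^o}, free_generator nakayama c.
Proof.
have [iota [iotad iota_inj iota_coh iota_surj]] := base_change G.
have [fgH [mu [mubij vanH phi]]] := H_tcy.
have [e [ec e0 exi egen]] := integral_cocycle xi_int.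
pose th (a : A) : {linear H^o -> pullmod D Ae^o} := thetaL G \o @lfree_in k H A a.
have thE a x : th a x = D x * tmul 1 (a : A^c) :> Ae by exact: thetaE.
(* [kappa] turns values in A^e into values in H ⊗ A, where a cocycle can be sliced; [theta] carries
   the slices back. *)
have decomp n (f : {linear fres (bimod A) n -> Ae^o}) :
  (forall x, f (dA n x) = 0) ->
  exists (r : seq (A * {linear A -> k^o}))
    (c : {linear A -> k^o} -> {linear fres (trivmod eps) n -> H^o}),
    (forall l x, c l (dk n x) = 0) /\
    @cohomologous _ _ dk (pullmod D Ae^o) n (fun x => f (iota n x))
      (fun x => \sum_(q <- r) th q.1 (c q.2 x)).
  move=> fc; pose g : {linear fres (trivmod eps) n -> lfree H A} :=
    kappaL G \o
    ((pull_map D f : {linear pullmod D (fres (bimod A) n) -> pullmod D Ae^o})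
      \o iota n).
  have gE x : g x = kappa G (f (iota n x)) by [].
  have [|r [c [cc gs]]] := cocycle_slices GH_rtriv fgH (g := g).
    by move=> x; rewrite gE -iotad fc; exact: (linear0 (kappaL G)).
  exists r, c; split=> //.
  have := cohomologous_comp (thetaL G) gs.
  apply: eq_cobound => x; congr (_ - _); last by rewrite linear_sum.
  by rewrite -[LHS]/(theta G (g x)) gE kappaK.
split.
  move=> n nn0 f fc; apply: iota_inj => //.
  have [r [c [cc fs]]] := decomp n f fc.
  apply: cobound_cohomologous (cohomologous_sym fs) _.
  have c0 l : cobound dk (c l).
    exact: (triv_ext_vanish GH_rtriv (vanH n nn0) (cc l)).
  have s0 := @cohomologous_sum _ _ dk (pullmod D Ae^o) n _ r
    (fun q x => th q.1 (c q.2 x)) (fun _ _ => 0)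
    (fun q => cohomologous0 (cobound_comp (th q.1) (c0 q.2))).
  by apply: eq_cobound s0 => x; rewrite [X in _ - X]big1 ?subr0.
(* The generator is the A^e-cocycle whose restriction along [iota] is cohomologous to D e. *)
have [|c [cc ce]] := iota_surj n0 Ae^o (dmapL G \o e).
  by move=> x; rewrite -[LHS]/(dmapL G (e _)) ec linear0.
have ceM (t : Ae) : @cohomologous _ _ dk (pullmod D Ae^o) n0
    (fun x => (c (iota n0 x) : Ae) * t) (fun x => D (e x) * t).
  pose m : {linear pullmod D Ae^o -> pullmod D Ae^o} := pull_map D (rmul t).
  by have := cohomologous_comp m ce; apply: eq_cobound.
pose ct t : {linear fres (bimod A) n0 -> Ae^o} := rmul t \o c.
have ctE t x : ct t x = (c x : Ae) * t by [].
have cM (t u : Ae) : @cohomologous _ _ dk (pullmod D Ae^o) n0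
    (fun x => D (e x) * t) (fun x => D (e x) * u) ->
    cohomologous dA (fun x => (c x : Ae) * t : Ae^o) (fun x => (c x : Ae) * u : Ae^o).
  move=> tu; apply: (iota_coh n0 Ae^o (ct t) (ct u)) => [x|x|].
  - by rewrite ctE cc mul0r.
  - by rewrite ctE cc mul0r.
  - exact: cohomologous_trans (cohomologous_trans (ceM t) tu)
      (cohomologous_sym (ceM u)).
exists c; split => //.
(* A functional equal to 1 at a nonzero a, applied after [kappa], recovers e from D(e) (1 ⊗ a); e
   would then be a coboundary. *)
- move=> a ca; apply/eqP/negPn/negP => a0; apply: e0.
  have [l [llin l1]] := exists_functional a0.
  have h := cobound_pull iotad ca.
  have := cobound_cohomologous (ceM (tmul 1 (a : A^c))) h.
  move/(cobound_comp (lfree_slice (mklin llin) \o kappaL G)).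
  apply: eq_cobound => x.
  rewrite -[LHS]/(lfree_slice (mklin llin) (kappa G (D (e x) * tmul 1 (a : A^c)))).
  rewrite -thetaE thetaK -[LHS]/(slice _ _) sliceE.
  by rewrite -[mklin llin a]/(l a) l1 scale1r.
(* Each slice is cohomologous to a scalar multiple of e, and these scalars are the coordinates of
   the coefficient a. *)
- move=> f fc; have [r [g [gc fs]]] := decomp n0 f fc.
  pose s l := sval (cid (egen (g l) (gc l))).
  have sE l : cohomologous dk (g l) (fun x => s l *: (e x : H) : H^o).
    by rewrite /s; case: cid.
  pose a := \sum_(q <- r) s q.2 *: q.1; exists a.
  apply: (iota_coh n0 Ae^o f (ct (tmul 1 (a : A^c)))) => [//|x|].
    by rewrite ctE cc mul0r.
  have s1 := @cohomologous_sum _ _ dk (pullmod D Ae^o) n0 _ r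
    (fun q x => th q.1 (g q.2 x)) (fun q x => th q.1 (s q.2 *: (e x : H)))
    (fun q => cohomologous_comp (th q.1) (sE q.2)).
  apply: (cohomologous_trans (cohomologous_trans fs s1)).
  apply: cohomologous_trans (cohomologous_sym (ceM _)).
  apply: eq_cohomologous => x; rewrite /a.
  rewrite -[tmul 1 _]/(tmul 1 (_ : A)) (@tmul_sumr k A A) mulr_sumr.
  apply: eq_bigr => q _; rewrite thE linearZ /= -scalerAl.
  by rewrite -[tmul 1 (_ *: _)]/(tmul 1 (_ *: q.1 : A^c)) tmulZr -scalerAr.
(* Here b ⊗ 1 is expanded as D(b_1) (1 ⊗ T(b_2)), and e b_1 is replaced by xi(b_1) e. *)
- move=> b; apply: cM.
  rewrite -(coact_twist G b) /nakayama.
  have bil1 : bilinear_fun (fun (h : H) (x : A) => D h * tmul 1 (twist G x : A^c)).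
    by split=> [h|x] u v w;
    rewrite !linearP ?tmulDr ?tmulZr (mulrDr, mulrDl) -?scalerAr -?scalerAl.
  have bil2 : bilinear_fun (fun (h : H) (x : A) => (xi h : k) *: twist G x).
    split=> [h|x] u v w; first by rewrite linearP scalerDr !scalerA mulrC.
    by rewrite linearP scalerDl -scalerA.
  have lin1 := linearD_fun (tens_lift_is_linear bil1).
  have lin2 := linearD_fun (tens_lift_is_linear bil2).
  elim/tens_ind: (coact G b) => [h x|t t' IH IH'].
    rewrite !tens_liftE //.
    have := cohomologous_comp (th (twist G x)) (exi h).
    apply: eq_cobound => y; rewrite !thE rmorphM -mulrA; congr (_ - _).
    rewrite linearZ /= -scalerAl.
    by rewrite -[tmul 1 (_ *: _)]/(tmul 1 (_ *: twist G x : A^c)) tmulZr -scalerAr.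
  rewrite lin1 lin2; have := cohomologousD IH IH'.
  by apply: eq_cobound => y; rewrite -mulrDr -mulrDr -tmulDr.
Qed.
End ExtTwisted.

Section TwoSided.
Variables (k : fieldType) (H K A : algType k).
Variables (epsH : {lrmorphism H -> k^o}) (epsK : {lrmorphism K -> k^o}).
Variables (GH : galois_datum H epsH) (G : galois_datum A epsH).
Variables (GK : galois_datum K epsK) (G' : galois_datum A epsK).
Hypothesis GH_rtriv : forall h, rtriv epsH (dmap GH h) = h.
Hypothesis GK_rtriv : forall h, rtriv epsK (dmap GK h) = h.
Variables (m n : nat).
Hypothesis H_tcy : twisted_calabi_yau H m.
Hypothesis K_tcy : twisted_calabi_yau K n.
Variables (xi : {lrmorphism H -> k^o}) (eta : {lrmorphism K -> k^o}).
Hypothesis xi_int : left_homological_integral epsH m xi.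
Hypothesis eta_int : left_homological_integral epsK n eta.

Lemma nakayama_unique : exists u v : A,
  [/\ u * v = 1, v * u = 1 & forall b, nakayama G xi b = v * nakayama G' eta b * u].
Proof.
have [van [c gc]] := ext_twisted G GH_rtriv H_tcy xi_int.
have [van' [c' gc']] := ext_twisted G' GK_rtriv K_tcy eta_int.
(* In distinct degrees, vanishing for K would make the generator for H a coboundary, and freeness
   would give 1 = 0 in A. *)
have mn : m = n.
  apply/eqP/negPn/negP => /eqP mn; have [cc ci _ _] := gc.
  have c0 := van' m mn c cc.
  have /eqP : (1 : A) = 0; last by rewrite oner_eq0.
  by apply: ci; apply: eq_cobound c0 => x; exact/esym/mulr1.
subst n; exact: free_generator_twist gc gc'.
Qed.
End TwoSided.

(** * Sweedler calculus *)

Section TensMapMorphism.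
Variables (k : fieldType) (A A' B B' : algType k).
Variables (f : {lrmorphism A -> A'}) (g : {lrmorphism B -> B'}).
Fact tens_map_multiplicative : monoid_morphism (tens_map f g).
Proof.
split=> [|t u]; first by rewrite tens_mapE !rmorph1.
elim/tens_ind: t => [a b|t t' IH IH']; last first.
  by rewrite mulrDl !(linearD (tens_map f g)) /= IH IH' mulrDl.
elim/tens_ind: u => [a' b'|u u' IH IH']; last first.
  by rewrite mulrDr !(linearD (tens_map f g)) /= IH IH' mulrDr.
by rewrite tmulM !tens_mapE tmulM !rmorphM.
Qed.
HB.instance Definition _ := GRing.isMonoidMorphism.Build (A ⊗ B) (A' ⊗ B')
  (tens_map f g) tens_map_multiplicative.
End TensMapMorphism.

Section TensLiftSum.
Variables (k : fieldType) (V W U : lmodType k).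

Lemma tens_lift_sum (B : V -> W -> U) (I : Type) (r : seq I) (v : I -> V) (w : I -> W) :
  bilinear_fun B ->
  tens_lift B (\sum_(i <- r) tmul (v i) (w i)) = \sum_(i <- r) B (v i) (w i).
Proof.
move=> Bbil; pose L := mklin (tens_lift_is_linear Bbil).
rewrite -[LHS]/(L _) linear_sum; apply: eq_bigr => i _.
exact: tens_liftE.
Qed.
End TensLiftSum.

Lemma tens_assoc_is_linear (k : fieldType) (U V W : lmodType k) :
  linear (@tens_assoc k U V W).
Proof.
apply: tens_lift_is_linear; split=> [s|w] c x y; last first.
  exact: (tens_lift_is_linear (tens_assoc_bil _ _ w)).
elim/tens_ind: s => [u v|s s' IH IH'].
  by rewrite !tens_liftE; try exact: tens_assoc_bil; rewrite !tmulDr !tmulZr.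
have L w := linearD_fun (tens_lift_is_linear (@tens_assoc_bil k U V W w)).
by rewrite !L IH IH' scalerDr addrACA.
Qed.

Lemma tens_map_sum (k : fieldType) (V V' W W' : lmodType k) (f : {linear V -> V'})
    (g : {linear W -> W'}) (I : Type) (r : seq I) (v : I -> V) (w : I -> W) :
  tens_map f g (\sum_(i <- r) tmul (v i) (w i)) = \sum_(i <- r) tmul (f (v i)) (g (w i)).
Proof. by rewrite linear_sum; apply: eq_bigr => i _; rewrite /= tens_mapE. Qed.

Section Sweedler.
Variables (k : fieldType) (C : cocategory k).
Implicit Types X Y Z T : ob C.

(** One chosen decomposition of the coproduct. The list itself is not additive in [a]; only sums of
    multilinear expressions over it are meaningful. *)
Definition sw X Y Z (a : C X Y) : seq (C X Z * C Z Y) :=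
  sval (cid (tens_sum (comul X Y Z a))).

Lemma comulE X Y Z (a : C X Y) :
  comul X Y Z a = \sum_(p <- sw Z a) tmul p.1 p.2.
Proof. by rewrite /sw; case: cid. Qed.

Lemma sw_lift (U : lmodType k) X Y Z (a : C X Y) (B : C X Z -> C Z Y -> U) :
  bilinear_fun B ->
  tens_lift B (comul X Y Z a) = \sum_(p <- sw Z a) B p.1 p.2.
Proof. by move=> Bbil; rewrite comulE tens_lift_sum. Qed.

Lemma sw_map X Y Z (V W : lmodType k) (f : {linear C X Z -> V})
    (g : {linear C Z Y -> W}) (a : C X Y) :
  tens_map f g (comul X Y Z a) = \sum_(p <- sw Z a) tmul (f p.1) (g p.2).
Proof. by rewrite comulE tens_map_sum. Qed.

Definition trilinear_fun (V1 V2 V3 U : lmodType k) (f : V1 -> V2 -> V3 -> U) :=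
  (forall x, bilinear_fun (f x)) /\ forall y z, linear (fun x => f x y z).

(** A trilinear function factors through the triple tensor product, where coassociativity
    applies. *)
Lemma sw_coassoc (U : lmodType k) X Y Z T (a : C X Y)
    (f : C X T -> C T Z -> C Z Y -> U) : trilinear_fun f ->
  \sum_(p <- sw Z a) \sum_(q <- sw T p.1) f q.1 q.2 p.2 =
  \sum_(p <- sw T a) \sum_(q <- sw Z p.2) f p.1 q.1 q.2.
Proof.
move=> [fbil flin].
pose g (x : C X T) (t : C T Z ⊗ C Z Y) : U := tens_lift (f x) t.
have gE x y z : g x (tmul y z) = f x y z by exact: tens_liftE.
have gD x : {morph g x : t u / t + u}.
  exact: linearD_fun (tens_lift_is_linear (fbil x)).
have gbil : bilinear_fun g.
  split=> [x|t] c u v; first exact: (tens_lift_is_linear (fbil x)).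
  elim/tens_ind: t => [y z|t t' IH IH']; first by rewrite !gE flin.
  by rewrite !gD IH IH' scalerDr addrACA.
have h := congr1 (tens_lift g) (@comulA k C X Y Z T a); move: h.
rewrite !sw_map.
have -> : tens_assoc (\sum_(p <- sw Z a) tmul (comul X Z T p.1) (idfun p.2)) =
  \sum_(p <- sw Z a) \sum_(q <- sw T p.1) tmul q.1 (tmul q.2 p.2).
  pose L := mklin (@tens_assoc_is_linear k (C X T) (C T Z) (C Z Y)).
  rewrite -[LHS]/(L _) linear_sum; apply: eq_bigr => p _.
  rewrite comulE tmul_suml linear_sum.
  by apply: eq_bigr => q _; exact: tens_assocE.
have gsum (I : Type) (r : seq I) F :
    tens_lift g (\sum_(i <- r) F i) = \sum_(i <- r) tens_lift g (F i).
  exact: (linear_sum (mklin (tens_lift_is_linear gbil))).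
rewrite gsum; under eq_bigr => p _ do
  (rewrite gsum; under eq_bigr => q _ do rewrite tens_liftE // gE).
move=> ->; rewrite gsum; apply: eq_bigr => p _.
by rewrite /= comulE tmul_sumr gsum; apply: eq_bigr => q _; rewrite tens_liftE // gE.
Qed.

Lemma sw_counitr X Y (a : C X Y) :
  \sum_(p <- sw Y a) (counit Y p.2 : k) *: p.1 = a.
Proof.
rewrite -[RHS]counitr sw_map /tens_runit tens_lift_sum //; exact: scale_bilr.
Qed.

Lemma sw_counitl X Y (a : C X Y) :
  \sum_(p <- sw X a) (counit X p.1 : k) *: p.2 = a.
Proof.
rewrite -[RHS]counitl sw_map /tens_lunit tens_lift_sum //; exact: scale_bill.
Qed.

Lemma sw_mul (U : lmodType k) X Y Z (a b : C X Y) (B : C X Z -> C Z Y -> U) :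
  bilinear_fun B ->
  \sum_(p <- sw Z (a * b)) B p.1 p.2 =
  \sum_(p <- sw Z a) \sum_(q <- sw Z b) B (p.1 * q.1) (p.2 * q.2).
Proof.
move=> Bbil; rewrite -sw_lift // rmorphM /= !comulE mulr_suml.
pose L := mklin (tens_lift_is_linear Bbil); rewrite -[LHS]/(L _) linear_sum.
apply: eq_bigr => p _; rewrite mulr_sumr linear_sum; apply: eq_bigr => q _.
by rewrite tmulM; exact: tens_liftE.
Qed.

End Sweedler.

Ltac multilinear :=
  let c := fresh "c" in let x := fresh "x" in let y := fresh "y" in
  intros c x y;
  repeat first [ rewrite linearP | rewrite mulrDl | rewrite mulrDr
    | rewrite tmulDl | rewrite tmulDr | rewrite tmulZl | rewrite tmulZr
    | rewrite -scalerAl | rewrite -scalerAr ];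
  reflexivity.

Section Antipode.
Variables (k : fieldType) (C : cogroupoid k).
Implicit Types X Y : ob C.
Local Notation S := antipode.

Lemma sw_antipoder X Y (a : C X X) :
  \sum_(p <- sw Y a) p.1 * S Y X p.2 = (counit X a : k) *: 1.
Proof.
rewrite -(antipoder Y a) sw_map /tens_mult tens_lift_sum //; exact: mul_bil.
Qed.

Lemma sw_antipodel X Y (a : C X X) :
  \sum_(p <- sw Y a) S X Y p.1 * p.2 = (counit X a : k) *: 1.
Proof.
rewrite -(antipodel Y a) sw_map /tens_mult tens_lift_sum //; exact: mul_bil.
Qed.

Lemma antipode1 X Y : S X Y 1 = 1.
Proof.
have := antipodel Y (1 : C X X); rewrite !rmorph1 tens_mapE /tens_mult tens_liftE.
  by rewrite mulr1 => ->; rewrite -[LHS]/((1 : k) *: 1) scale1r.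
exact: mul_bil.
Qed.

(* Both sides equal the sum of S(a_1 b_1) a_2 b_2 S(b_3) S(a_3). *)
Lemma antipodeM X Y (a b : C X Y) : S X Y (a * b) = S X Y b * S X Y a.
Proof.
pose F (t u : C X Y * C Y X * C X Y) : C Y X :=
  S X Y (t.1.1 * u.1.1) * (t.1.2 * u.1.2) * S X Y u.2 * S X Y t.2.
pose sl (x : C X Y) := [seq (q.1, q.2, p.2) | p <- sw X x, q <- sw Y p.1].
pose sr (x : C X Y) := [seq (p.1, q.1, q.2) | p <- sw Y x, q <- sw X p.2].
have coassoc x (f : C X Y * C Y X * C X Y -> C Y X) :
    trilinear_fun (fun u v w => f (u, v, w)) ->
    \sum_(t <- sl x) f t = \sum_(t <- sr x) f t.
  by move=> ftri; rewrite !big_allpairs_dep; exact: (sw_coassoc x ftri).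
(* Bracketed on the left, S(a_1 b_1) a_2 b_2 collapses to a counit. *)
have L : \sum_(t <- sl a) \sum_(u <- sl b) F t u = S X Y b * S X Y a.
  rewrite big_allpairs_dep /=.
  transitivity (\sum_(p <- sw X a) (counit X p.1 : k) *: (S X Y b * S X Y p.2)).
    apply: eq_bigr => p _.
    under eq_bigr => q _ do rewrite big_allpairs_dep /=.
    rewrite exchange_big /=.
    transitivity (\sum_(s <- sw X b) ((counit X p.1 : k) * (counit X s.1 : k))
        *: (S X Y s.2 * S X Y p.2)).
      apply: eq_bigr => s _.
      transitivity (((counit X (p.1 * s.1) : k) *: 1) * S X Y s.2 * S X Y p.2).
        rewrite -(sw_antipodel Y) (@sw_mul _ _ _ _ _ _ _ _ (fun x y => S X Y x * y));
          last by split=> [x|y]; multilinear.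
        rewrite !mulr_suml; apply: eq_bigr => q _.
        by rewrite !mulr_suml.
      by rewrite rmorphM -!scalerAl mul1r.
    rewrite -[in RHS](sw_counitl b) linear_sum mulr_suml scaler_sumr.
    by apply: eq_bigr => s _; rewrite linearZ /= -scalerAl scalerA.
  rewrite -[in RHS](sw_counitl a) linear_sum mulr_sumr.
  by apply: eq_bigr => p _; rewrite linearZ /= -scalerAr.
(* Bracketed on the right, first b_2 S(b_3) and then a_2 S(a_3) collapse. *)
have R : \sum_(t <- sr a) \sum_(u <- sr b) F t u = S X Y (a * b).
  rewrite big_allpairs_dep /=.
  transitivity (\sum_(p <- sw Y a) (counit Y p.2 : k) *: S X Y (p.1 * b)).
    apply: eq_bigr => p _.
    transitivity (\sum_(q <- sw X p.2) S X Y (p.1 * b) * (q.1 * S X Y q.2)); last first.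
      by rewrite -mulr_sumr sw_antipoder -scalerAr mulr1.
    apply: eq_bigr => q _; rewrite big_allpairs_dep /=.
    transitivity (\sum_(s <- sw Y b) (counit Y s.2 : k) *:
        (S X Y (p.1 * s.1) * (q.1 * S X Y q.2))).
      apply: eq_bigr => s _.
      transitivity (S X Y (p.1 * s.1) * q.1 *
          (\sum_(r <- sw X s.2) r.1 * S X Y r.2) * S X Y q.2).
        rewrite mulr_sumr mulr_suml; apply: eq_bigr => r _.
        by rewrite /F /= !mulrA.
      by rewrite sw_antipoder -scalerAr mulr1 -scalerAl mulrA.
    rewrite -[in RHS](sw_counitr b) mulr_sumr linear_sum mulr_suml.
    by apply: eq_bigr => s _; rewrite -scalerAr linearZ /= -scalerAl.
  rewrite -[in RHS](sw_counitr a) mulr_suml linear_sum.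
  by apply: eq_bigr => p _; rewrite -scalerAl linearZ.
rewrite -R -L; transitivity (\sum_(u <- sr b) \sum_(t <- sl a) F t u).
  rewrite exchange_big /=; apply: eq_bigr => u _; apply/esym/coassoc.
  rewrite /F /=; split=> [x|y z]; last by multilinear.
  by split=> [y|z]; multilinear.
rewrite exchange_big /=; apply: eq_bigr => t _; apply/esym/coassoc.
rewrite /F /=; split=> [x|y z]; last by multilinear.
by split=> [y|z]; multilinear.
Qed.

Lemma counit_antipode X (a : C X X) : counit X (S X X a) = counit X a.
Proof.
rewrite -[in LHS](sw_counitr a) !linear_sum /=.
have := congr1 (counit X) (sw_antipodel X a).
rewrite linear_sum linearZ /= rmorph1 -[RHS]/((counit X a : k) * 1) mulr1 => <-.
apply: eq_bigr => p _; rewrite !linearZ rmorphM mulrC.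
by [].
Qed.

(** With the opposite algebra as target, the antipode is a homomorphism, so that [cog_dmap] is one
    by composition. *)
Definition antipode_op X Y : C X Y -> (C Y X)^c := antipode X Y.
Fact antipode_op_is_linear X Y : linear (@antipode_op X Y).
Proof. by move=> c x y; rewrite /antipode_op linearP. Qed.
HB.instance Definition _ X Y := GRing.isLinear.Build k (C X Y) (C Y X)^c _
  (@antipode_op X Y) (@antipode_op_is_linear X Y).
Fact antipode_op_multiplicative X Y : monoid_morphism (@antipode_op X Y).
Proof.
by split=> [|x y]; [exact: antipode1 | exact: antipodeM].
Qed.
HB.instance Definition _ X Y := GRing.isMonoidMorphism.Build (C X Y) (C Y X)^c
  (@antipode_op X Y) (@antipode_op_multiplicative X Y).

End Antipode.

(** * The Galois datum of a cogroupoid *)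

Lemma tmul_trilinear (k : fieldType) (U V W Z : lmodType k) (B : V -> W -> Z) :
  bilinear_fun B -> trilinear_fun (fun (x : U) y z => tmul x (B y z)).
Proof.
move=> [Br Bl]; split=> [x|y z]; last by multilinear.
by split=> [y|z] c u v; rewrite (Br, Bl) tmulDr tmulZr.
Qed.

Section Datum.
Variables (k : fieldType) (C : cogroupoid k) (X Y : ob C).
Local Notation S := antipode.
Local Notation H := (C X X).
Local Notation A := (C X Y).
Local Notation Ae := (envel (C X Y)).

Definition cog_dmap : {lrmorphism H -> Ae} :=
  tens_map idfun (@antipode_op k C Y X) \o comul X X Y.

Definition cog_twist : {linear A -> A} := S Y X \o S X Y.

Lemma cog_dmapE (h : H) :
  cog_dmap h = \sum_(p <- sw Y h) tmul p.1 (S Y X p.2 : A^c).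
Proof. by rewrite /= sw_map. Qed.

(** Coassociativity reduces this to a_1 ⊗ S(a_2) a_3 = a ⊗ 1; the next lemma is likewise h_1 ⊗ h_2
    S(h_3) = h ⊗ 1. *)
Lemma cog_coact_dmap (a : A) : tens_lift (fun (h : H) (x : A) =>
  tmul 1 (x : A^c) * cog_dmap h) (comul X Y X a) = tmul a 1.
Proof.
rewrite sw_lift; last by split=> [h|x]; multilinear.
transitivity (\sum_(p <- sw X a) \sum_(q <- sw Y p.1)
    (tmul q.1 (S Y X q.2 * p.2 : A) : Ae)).
  apply: eq_bigr => p _; rewrite cog_dmapE mulr_sumr; apply: eq_bigr => q _.
  by rewrite tmulM mul1r.
rewrite (@sw_coassoc _ _ Ae _ _ _ _ _ (fun x y z => tmul x (S Y X y * z : A))).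
  rewrite -[in RHS](sw_counitr a) tmul_suml; apply: eq_bigr => p _.
  rewrite -(tmul_sumr (W := A^c)) [X in tmul _ X]sw_antipodel.
  by rewrite tmulZl -tmulZr.
apply: (@tmul_trilinear _ _ _ _ A^c (fun y z => S Y X y * z : A)).
by split=> [y|z]; multilinear.
Qed.

Lemma cog_dmap_coact (h : H) : tens_lift (fun (x : A) (y : A^c) =>
  comul X Y X x * tmul 1 (y : A)) (cog_dmap h) = tmul h 1.
Proof.
rewrite cog_dmapE tens_lift_sum; last by split=> [x|y]; multilinear.
transitivity (\sum_(p <- sw Y h) \sum_(q <- sw X p.1)
    (tmul q.1 (q.2 * S Y X p.2) : H ⊗ A)).
  apply: eq_bigr => p _; rewrite comulE mulr_suml; apply: eq_bigr => q _.
  by rewrite tmulM mulr1.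
rewrite (@sw_coassoc _ _ (H ⊗ A) _ _ _ _ _ (fun x y z => tmul x (y * S Y X z))).
  rewrite -[in RHS](sw_counitr h) tmul_suml; apply: eq_bigr => p _.
  by rewrite -tmul_sumr [X in tmul _ X]sw_antipoder tmulZl -tmulZr.
by apply: tmul_trilinear; split=> [y|z]; multilinear.
Qed.

Lemma cog_dmap_act1 (h : H) : bimod_act (cog_dmap h) 1 = (counit X h : k)%:A.
Proof.
rewrite cog_dmapE /bimod_act tens_lift_sum; last exact: bimod_act_bil.
rewrite -[RHS](sw_antipoder Y); apply: eq_bigr => p _.
by rewrite mulr1.
Qed.

(** Antimultiplicativity gathers the second legs into S(a_2 S(a_3)), and in the next lemma into
    S(S(h_2) h_3): an antipode relation under one more S. *)
Lemma cog_coact_twist (a : A) : tens_lift (fun (h : H) (x : A) =>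
  cog_dmap h * tmul 1 (cog_twist x : A^c)) (comul X Y X a) = tmul a 1.
Proof.
rewrite sw_lift; last by split=> [h|x]; multilinear.
transitivity (\sum_(p <- sw X a) \sum_(q <- sw Y p.1)
    (tmul q.1 (S Y X (q.2 * S X Y p.2) : A) : Ae)).
  apply: eq_bigr => p _; rewrite cog_dmapE mulr_suml; apply: eq_bigr => q _.
  by rewrite tmulM mulr1 antipodeM.
rewrite (@sw_coassoc _ _ Ae _ _ _ _ _
  (fun x y z => tmul x (S Y X (y * S X Y z) : A))).
  rewrite -[in RHS](sw_counitr a) tmul_suml; apply: eq_bigr => p _.
  rewrite -(tmul_sumr (W := A^c)) -linear_sum sw_antipoder linearZ antipode1.
  by rewrite tmulZl -tmulZr.
apply: (@tmul_trilinear _ _ _ _ A^c (fun y z => S Y X (y * S X Y z) : A)).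
by split=> [y|z]; multilinear.
Qed.

Lemma cog_dmap_twist (h : H) : tens_lift (fun (x : A) (y : A^c) =>
  tmul 1 (y : A) * tens_map idfun cog_twist (comul X Y X x)) (cog_dmap h)
  = tmul h 1.
Proof.
have bil : bilinear_fun (fun (x : A) (y : A^c) =>
    tmul 1 (y : A) * tens_map idfun cog_twist (comul X Y X x)).
  split=> [x|y] c v w; first by rewrite tmulDr tmulZr mulrDl -scalerAl.
  by rewrite (linearP (comul X Y X)) (tens_map_is_linear idfun cog_twist) mulrDr -scalerAr.
rewrite cog_dmapE tens_lift_sum //.
transitivity (\sum_(p <- sw Y h) \sum_(q <- sw X p.1)
    (tmul q.1 (S Y X (S X Y q.2 * p.2)) : H ⊗ A)).
  apply: eq_bigr => p _; rewrite sw_map mulr_sumr; apply: eq_bigr => q _.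
  by rewrite tmulM mul1r antipodeM.
rewrite (@sw_coassoc _ _ (H ⊗ A) _ _ _ _ _
  (fun x y z => tmul x (S Y X (S X Y y * z)))).
  rewrite -[in RHS](sw_counitr h) tmul_suml; apply: eq_bigr => p _.
  by rewrite -tmul_sumr -linear_sum sw_antipodel linearZ antipode1 tmulZl -tmulZr.
by apply: tmul_trilinear; split=> [y|z]; multilinear.
Qed.

Definition cog_datum : galois_datum (C X Y) (counit X) :=
  GaloisDatum cog_coact_dmap cog_dmap_coact cog_dmap_act1
    cog_coact_twist cog_dmap_twist.

Lemma nakayama_cog (xi : {lrmorphism H -> k^o}) (b : A) :
  nakayama cog_datum xi b = S Y X (S X Y (winding_left xi b)).
Proof.
have bil1 : bilinear_fun (fun (h : H) (x : A) => (xi h : k) *: cog_twist x).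
  split=> [h|x] u v w; first by rewrite linearP scalerDr !scalerA mulrC.
  by rewrite linearP scalerDl -scalerA.
rewrite /nakayama /winding_left sw_lift // sw_map /tens_lunit.
rewrite (tens_lift_sum _ _ _ (scale_bill A)).
by rewrite !linear_sum; apply: eq_bigr => p _; rewrite !linearZ.
Qed.

End Datum.

Lemma rtriv_cog (k : fieldType) (C : cogroupoid k) (X : ob C) (h : C X X) :
  rtriv (counit X) (dmap (cog_datum X X) h) = h.
Proof.
rewrite -[dmap _ h]/(cog_dmap X X h) cog_dmapE linear_sum -[RHS](sw_counitr h).
by apply: eq_bigr => p _; rewrite /= rtrivE counit_antipode.
Qed.

(** * Winding automorphisms *)

Section WindingLeft.
Variables (k : fieldType) (C : cogroupoid k) (X Y : ob C).
Variable xi : {lrmorphism C X X -> k^o}.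

Lemma winding_leftE (a : C X Y) :
  winding_left xi a = \sum_(p <- sw X a) (xi p.1 : k) *: p.2.
Proof.
rewrite /winding_left sw_map /tens_lunit tens_lift_sum //; exact: scale_bill.
Qed.

(** Winding by xi S, the convolution inverse of xi. *)
Definition winding_left_inv (a : C X Y) : C X Y :=
  \sum_(p <- sw X a) (xi (antipode X X p.1) : k) *: p.2.

Lemma winding_bil (f : {linear C X X -> k^o}) :
  bilinear_fun (fun (x : C X X) (y : C X Y) => (f x : k) *: y).
Proof.
split=> [h|x] u v w; first by rewrite scalerDr !scalerA mulrC.
by rewrite linearP scalerDl -scalerA.
Qed.

Lemma winding_linear (f : {linear C X X -> k^o}) :
  linear (fun a : C X Y => \sum_(p <- sw X a) (f p.1 : k) *: p.2).
Proof.
move=> c x y; have bil := winding_bil f.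
by rewrite -!(sw_lift _ bil) linearP; exact: tens_lift_is_linear.
Qed.

(** Composition of windings is convolution of functionals. Linear functionals suffice, so xi S can
    be used without a proof that it is multiplicative. *)
Lemma winding_comp (f g : {linear C X X -> k^o}) (a : C X Y) :
  (forall h : C X X, \sum_(p <- sw X h) (g p.1 : k) * f p.2 = counit X h) ->
  \sum_(p <- sw X (\sum_(q <- sw X a) (g q.1 : k) *: q.2)) (f p.1 : k) *: p.2 = a.
Proof.
move=> fg; pose F := mklin (winding_linear f).
rewrite -[LHS]/(F _) linear_sum.
transitivity (\sum_(q <- sw X a) \sum_(p <- sw X q.2)
   ((g q.1 : k) * (f p.1 : k)) *: p.2).
  apply: eq_bigr => q _; rewrite (linearZ_LR F) [LHS]scaler_sumr.
  by apply: eq_bigr => p _; rewrite scalerA.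
rewrite -(@sw_coassoc _ _ (C X Y) _ _ _ _ a
  (fun x y z => ((g x : k) * (f y : k)) *: z)).
  rewrite -[RHS](sw_counitl a); apply: eq_bigr => p _.
  by rewrite -scaler_suml fg.
split=> [x|y z]; last first.
  move=> c u v; rewrite linearP.
  rewrite -[LHS]/((((c * g u) + g v) * f y : k) *: z) mulrDl scalerDl.
  by rewrite -mulrA -[(c * _) *: z]scalerA.
split=> [y|z] c u v; first by rewrite scalerDr !scalerA mulrC.
rewrite linearP -[LHS]/((g x * (c * f u + f v) : k) *: z).
by rewrite mulrDr scalerDl mulrCA -[(c * _) *: z]scalerA.
Qed.

End WindingLeft.

Section WindingLeftBijective.
Variables (k : fieldType) (C : cogroupoid k) (X Y : ob C).
Variable xi : {lrmorphism C X X -> k^o}.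

Lemma winding_leftK : cancel (winding_left xi) (@winding_left_inv k C X Y xi).
Proof.
move=> a; rewrite winding_leftE.
apply: (winding_comp (f := xi \o antipode X X)) => h.
rewrite -[RHS]mulr1 -[RHS]/((counit X h : k) *: (1 : k^o)) -(rmorph1 xi).
rewrite -(linearZ_LR xi) -(sw_antipoder X) linear_sum.
by apply: eq_bigr => p _; rewrite rmorphM.
Qed.

Lemma winding_left_invK : cancel (@winding_left_inv k C X Y xi) (winding_left xi).
Proof.
move=> a; rewrite winding_leftE.
apply: (winding_comp (g := xi \o antipode X X)) => h.
rewrite -[RHS]mulr1 -[RHS]/((counit X h : k) *: (1 : k^o)) -(rmorph1 xi).
rewrite -(linearZ_LR xi) -(sw_antipodel X) linear_sum.
by apply: eq_bigr => p _; rewrite rmorphM.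
Qed.

Lemma winding_leftM (a b : C X Y) :
  winding_left xi (a * b) = winding_left xi a * winding_left xi b.
Proof.
rewrite !winding_leftE (@sw_mul _ _ _ _ _ _ _ _ (fun x y => (xi x : k) *: y));
  last exact: winding_bil.
rewrite mulr_suml; apply: eq_bigr => p _; rewrite mulr_sumr.
by apply: eq_bigr => q _; rewrite rmorphM -scalerAl -scalerAr scalerA.
Qed.

Lemma winding_left1 : winding_left xi (1 : C X Y) = 1.
Proof. by rewrite /winding_left rmorph1 tens_mapE !rmorph1 tens_lunitE scale1r. Qed.

End WindingLeftBijective.

(** * The co-opposite cogroupoid *)

Section Flip.
Variables (k : fieldType) (V W : lmodType k).
Definition tens_flip : V ⊗ W -> W ⊗ V := tens_lift (fun v w => tmul w v).
Lemma flip_bil : bilinear_fun (fun (v : V) (w : W) => tmul w v).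
Proof. by split=> [v|w]; multilinear. Qed.
Lemma tens_flipE v w : tens_flip (tmul v w) = tmul w v.
Proof. by rewrite /tens_flip tens_liftE //; exact: flip_bil. Qed.
Fact tens_flip_is_linear : linear tens_flip.
Proof. exact: tens_lift_is_linear flip_bil. Qed.
HB.instance Definition _ := GRing.isLinear.Build k _ _ _ tens_flip tens_flip_is_linear.
End Flip.

Section FlipAlgebra.
Variables (k : fieldType) (A B : algType k).
Fact tens_flip_multiplicative : monoid_morphism (@tens_flip k A B).
Proof.
split=> [|t u]; first by rewrite tens_flipE.
elim/tens_ind: t => [a b|t t' IH IH']; last first.
  by rewrite mulrDl !(linearD (@tens_flip k A B)) /= IH IH' mulrDl.
elim/tens_ind: u => [a' b'|u u' IH IH']; last first.
  by rewrite mulrDr !(linearD (@tens_flip k A B)) /= IH IH' mulrDr.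
by rewrite tmulM !tens_flipE tmulM.
Qed.
HB.instance Definition _ := GRing.isMonoidMorphism.Build (A ⊗ B) (B ⊗ A)
  (@tens_flip k A B) tens_flip_multiplicative.
End FlipAlgebra.

Section Coopposite.
Variables (k : fieldType) (C : cogroupoid k).

Definition cop_coalg (X Y : ob C) : algType k := C Y X.
Definition cop_comul (X Y Z : ob C) :
    {lrmorphism cop_coalg X Y -> cop_coalg X Z ⊗ cop_coalg Z Y} :=
  @tens_flip k (C Y Z) (C Z X) \o comul Y X Z.

Lemma cop_comulE X Y Z (a : C Y X) :
  cop_comul X Y Z a = \sum_(p <- sw Z a) tmul p.2 p.1.
Proof.
rewrite /= comulE linear_sum; apply: eq_bigr => p _; exact: tens_flipE.
Qed.

Lemma cop_comulA X Y Z T (a : cop_coalg X Y) :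
  tens_assoc (tens_map (cop_comul X Z T) idfun (cop_comul X Y Z a))
  = tens_map idfun (cop_comul T Y Z) (cop_comul X Y T a).
Proof.
pose L := mklin (@tens_assoc_is_linear k (C T X) (C Z T) (C Y Z)).
rewrite !cop_comulE !tens_map_sum -[LHS]/(L _) linear_sum.
transitivity (\sum_(p <- sw Z a) \sum_(q <- sw T p.2) tmul q.2 (tmul q.1 p.1)).
  apply: eq_bigr => p _; rewrite -[tmul _ _]/(tmul (cop_comul X Z T p.2) p.1).
  rewrite cop_comulE tmul_suml linear_sum.
  by apply: eq_bigr => q _; exact: tens_assocE.
rewrite -(@sw_coassoc _ _ _ _ _ _ _ _ (fun x y z => tmul z (tmul y x))).
  apply: eq_bigr => p _.
  rewrite -[RHS]/(tmul p.2 (cop_comul T Y Z p.1)) cop_comulE tmul_sumr.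
  by [].
by split=> [x|y z]; last multilinear; split=> [y|z]; multilinear.
Qed.

Lemma cop_counitr X Y (a : cop_coalg X Y) :
  tens_runit (tens_map idfun (counit Y) (cop_comul X Y Y a)) = a.
Proof.
rewrite -[RHS](sw_counitl a) cop_comulE.
rewrite tens_map_sum /tens_runit tens_lift_sum //; exact: scale_bilr.
Qed.

Lemma cop_counitl X Y (a : cop_coalg X Y) :
  tens_lunit (tens_map (counit X) idfun (cop_comul X Y X a)) = a.
Proof.
rewrite -[RHS](sw_counitr a) cop_comulE.
rewrite tens_map_sum /tens_lunit tens_lift_sum //; exact: scale_bill.
Qed.

Definition cop_cocategory : cocategory k :=
  Cocategory cop_comulA cop_counitr cop_counitl.

Hypothesis S_bij : forall X Y : ob C, bijective (antipode X Y).

Lemma antipode_surj X Y (y : C Y X) : exists x, antipode X Y x = y.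
Proof. by have [g _ gK] := S_bij X Y; exists (g y). Qed.

Definition antipode_inv X Y (y : C Y X) : C X Y := sval (cid (antipode_surj y)).
Lemma antipode_invK X Y : cancel (@antipode_inv X Y) (antipode X Y).
Proof. by move=> y; rewrite /antipode_inv; case: cid. Qed.

Fact antipode_inv_is_linear X Y : linear (@antipode_inv X Y).
Proof.
move=> c x y; apply: (bij_inj (S_bij X Y)).
by rewrite linearP !antipode_invK.
Qed.
Definition cop_antipode (X Y : ob C) :
  {linear cop_coalg X Y -> cop_coalg Y X} := mklin (@antipode_inv_is_linear X Y).

(** S is injective and reverses products: applied to a_2 S^-1(a_1), it gives a_1 S(a_2), the
    relation in [C]. *)
Lemma cop_antipoder X Y (a : cop_coalg X X) :
  tens_mult (tens_map idfun (cop_antipode Y X) (cop_comul X X Y a))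
  = (counit X a : k)%:A.
Proof.
apply: (bij_inj (S_bij Y X)); rewrite cop_comulE tens_map_sum.
rewrite /tens_mult tens_lift_sum; last exact: mul_bil.
rewrite linearZ antipode1 -[RHS](sw_antipoder Y) linear_sum; apply: eq_bigr => p _.
by rewrite antipodeM; congr (_ * _); exact: antipode_invK.
Qed.

Lemma cop_antipodel X Y (a : cop_coalg X X) :
  tens_mult (tens_map (cop_antipode X Y) idfun (cop_comul X X Y a))
  = (counit X a : k)%:A.
Proof.
apply: (bij_inj (S_bij X Y)); rewrite cop_comulE tens_map_sum.
rewrite /tens_mult tens_lift_sum; last exact: mul_bil.
rewrite linearZ antipode1 -[RHS](sw_antipodel Y) linear_sum; apply: eq_bigr => p _.
by rewrite antipodeM; congr (_ * _); exact: antipode_invK.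
Qed.

Definition cop : cogroupoid k :=
  @Cogroupoid k cop_cocategory cop_antipode cop_antipoder cop_antipodel.

Lemma winding_right_cop (X Y : ob C) (eta : {lrmorphism C Y Y -> k^o}) (a : C X Y) :
  winding_right eta a = @winding_left k cop Y X eta a.
Proof.
rewrite /winding_right sw_map /tens_runit tens_lift_sum; last exact: scale_bilr.
rewrite /winding_left -[comul (c := cop) _ _ _ _]/(cop_comul Y X Y a) cop_comulE.
rewrite tens_map_sum /tens_lunit tens_lift_sum //; exact: scale_bill.
Qed.

End Coopposite.

(** * The fourth power of the antipode *)

Theorem theorem2p5p9 (k : fieldType) (C : cogroupoid k)
    (C_connected : connected C)
    (S_bij : forall X' Y' : ob C, bijective (antipode X' Y'))
    (X Y : ob C) (dX dY : nat)
    (CX_tcy : twisted_calabi_yau (C X X) dX)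
    (CY_tcy : twisted_calabi_yau (C Y Y) dY)
    (xi : {lrmorphism C X X -> k^o}) (eta : {lrmorphism C Y Y -> k^o})
    (xi_int : left_homological_integral (counit X) dX xi)
    (eta_int : left_homological_integral (counit Y) dY eta) :
  exists winv gamma : C X Y -> C X Y,
    [/\ cancel (winding_left xi) winv, cancel winv (winding_left xi),
        inner_automorphism gamma
      & iter 2 (antipode Y X \o antipode X Y)
        =1 winding_right eta \o winv \o gamma].
Proof.
pose K := cop S_bij.
(* In the co-opposite, the algebra from Y to X is C(X, Y) itself, so both data concern the same
   A^e. *)
pose G' : galois_datum (C X Y) (counit Y) := @cog_datum k K Y X.
pose GK : galois_datum (C Y Y) (counit Y) := @cog_datum k K Y Y.
have GK_rtriv : forall h, rtriv (counit Y) (dmap GK h) = h := @rtriv_cog k K Y.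
have [u [v [uv vu nuE]]] := nakayama_unique (cog_datum X Y) G' (@rtriv_cog k C X)
  GK_rtriv CX_tcy CY_tcy xi_int eta_int.
pose w : C X Y -> C X Y := winding_left xi.
pose w' : C X Y -> C X Y := @winding_left k K Y X eta.
pose winv : C X Y -> C X Y := winding_left_inv xi.
pose winv' : C X Y -> C X Y := @winding_left_inv k K Y X eta.
have wK : cancel w winv := @winding_leftK k C X Y xi.
have winvK : cancel winv w := @winding_left_invK k C X Y xi.
have wK' : cancel w' winv' := @winding_leftK k K Y X eta.
have winvK' : cancel winv' w' := @winding_left_invK k K Y X eta.
have wM : {morph w : a b / a * b} := @winding_leftM k C X Y xi.
have wM' : {morph w' : a b / a * b} := @winding_leftM k K Y X eta.
have w1 : w 1 = 1 := @winding_left1 k C X Y xi.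
have w1' : w' 1 = 1 := @winding_left1 k K Y X eta.
pose T (a : C X Y) := antipode Y X (antipode X Y a).
have TM : {morph T : a b / a * b} by move=> a b; rewrite /T !antipodeM.
have T1 : T 1 = 1 by rewrite /T !antipode1.
(* The twist of the co-opposite is T^-1, so the comparison reads T(w b) = v T^-1(w' b) u; applying T
   clears the inverse. *)
have key b : T (T (w b)) = T v * w' b * T u.
  rewrite -[T (w b)]nakayama_cog nuE !TM; congr (_ * _ * _).
  rewrite -[nakayama G' _ _]/(nakayama (@cog_datum k K Y X) eta b) nakayama_cog.
  rewrite /T -[antipode (c := K) X Y _]/(antipode_inv S_bij _) antipode_invK.
  exact: antipode_invK.
have winvM : {morph winv : a b / a * b}.
  by move=> a b; apply: (can_inj wK); rewrite wM !winvK.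
(* The conjugation obtained from [key] acts after g = [eta]^r ([xi]^l)^-1. As g is an algebra
   automorphism, moving the units through its inverse makes the conjugation act first, as gamma
   must. *)
pose g (a : C X Y) := w' (winv a); pose ginv (a : C X Y) := w (winv' a).
have ginvK : cancel ginv g by move=> a; rewrite /g /ginv wK winvK'.
have gK : cancel g ginv by move=> a; rewrite /g /ginv wK' winvK.
have gM : {morph g : a b / a * b} by move=> a b; rewrite /g winvM wM'.
have g1 : g 1 = 1 by rewrite /g -w1 wK w1'.
exists winv, (fun a => ginv (T v) * a * ginv (T u)); split=> //.
- exists (ginv (T v)), (ginv (T u)); split=> //; apply: (can_inj gK).
  + by rewrite gM !ginvK g1 -TM vu T1.
  + by rewrite gM !ginvK g1 -TM uv T1.
- move=> a; rewrite -[LHS]/(T (T a)) -[in LHS](winvK a) key.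
  rewrite -[RHS]/(winding_right eta (winv _)) (winding_right_cop S_bij).
  by rewrite -[RHS]/(g _) !gM !ginvK.
Qed.
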